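(* For a positive integer $n$, let $N(2n)$ be the number of distinct $S(3,\{4,6\},2n)$ designs on a fixed $2n$-element point set. There is a constant $c>0$ such that $\ln N(2n)> c\, n^3\ln n$ for all sufficiently large $n$.
   Context: An $S(3,\{4,6\},v)$ is a pair $(X,B)$ with $|X|=v$ and $B$ a set of subsets of $X$ each of size $4$ or $6$, such that every $3$-element subset of $X$ is contained in exactly one member of $B$. *)

(* Defs.v *)
From mathcomp Require Import all_boot.
Set Implicit Arguments. Unset Strict Implicit. Unset Printing Implicit Defensive.

Definition is_S3_46 (v : nat) (B : {set {set 'I_v}}) : bool :=
  [forall b in B, (#|b| == 4) || (#|b| == 6)] &&
  [forall T : {set 'I_v}, (#|T| == 3) ==> (#|[set b in B | T \subset b]| == 1)].

Definition N_S3_46 (v : nat) : nat := #|[set B : {set {set 'I_v}} | is_S3_46 B]|.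

(* Main.v *)
Require Import Defs.
From mathcomp Require Import all_boot all_algebra boolp ring zify.

(** Existence of a design for every even order [v] follows by induction from three
    constructions, [v = 2m], [v = 4m - 2] and [v = 4m + 2] with [m] even, each of
    which contains two copies [W_0], [W_1] of an [m]-set [W] and, for an arbitrary
    one-factorization [F] of the complete graph on [W], (essentially) all blocks
    [{z_0, z'_0, w_1, w'_1}] with [F z z' = F w w']. The factorization [F] can be
    chosen to contain the Cayley table of [E = Z_2^k] with [2^k] proportional to [m];
    the design then has four disjoint copies of [E] such that [{a, b, c, d}] is a block
    whenever [a + b + c + d = 0]. These blocks form a linear Latin cube, which may be
    replaced by any Latin cube on [E].

    There are at least [q ^ (q ^ 3)] Latin cubes with [q] proportional to [2^k]: inside
    the linear cube the eight cells of a box [p + {0, e}^3] may be switched by adding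
    [e] to the value, for any nonzero [e]; disjoint boxes may be switched
    simultaneously, and there is room to choose, for each of [q^3] base points [p]
    successively, one of at least [q] directions [e] that keep the boxes disjoint. *)

Set Implicit Arguments. Unset Strict Implicit. Unset Printing Implicit Defensive.
Import GRing.Theory.

(** * Designs *)

Ltac set_perm := apply/setP => ?; rewrite !inE; do !case: (_ == _).

Lemma subset3 (T : finType) (x y z : T) (b : {set T}) :
  ([set x; y; z] \subset b) = [&& x \in b, y \in b & z \in b].
Proof. by rewrite !subUset !sub1set andbA. Qed.

Lemma set3C (T : finType) (x y z : T) : [set x; y; z] = [set y; x; z].
Proof. by set_perm. Qed.

Lemma set3CA (T : finType) (x y z : T) : [set x; y; z] = [set x; z; y].
Proof. by set_perm. Qed.

Lemma cards3_neq (T : finType) (x y z : T) :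
  x != y -> x != z -> y != z -> #|[set x; y; z]| = 3.
Proof.
by move=> xy xz yz; rewrite -setUA cardsU1 cards2 !inE negb_or xy xz yz.
Qed.

Lemma cards4_neq (T : finType) (x y z w : T) :
  x != y -> x != z -> x != w -> y != z -> y != w -> z != w ->
  #|[set x; y; z; w]| = 4.
Proof.
move=> xy xz xw yz yw zw.
by rewrite setUC cardsU1 cards3_neq // !inE !negb_or eq_sym xw eq_sym yw eq_sym zw.
Qed.

Lemma cards3P (T : finType) (t : {set T}) : #|t| = 3 ->
  exists x y z, [/\ x != y, x != z, y != z & t = [set x; y; z]].
Proof.
move=> t3; have /card_gt0P [x xt] : 0 < #|t| by rewrite t3.
have := cardsD1 x t; rewrite xt t3 add1n => -[] /esym /eqP.
move=> /cards2P [y [z [yz et]]].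
have /setD1P [yx _] : y \in t :\ x by rewrite et !inE eqxx.
have /setD1P [zx _] : z \in t :\ x by rewrite et !inE eqxx orbT.
exists x, y, z; split; rewrite // 1?eq_sym //.
by rewrite -setUA -et setD1K.
Qed.

Lemma subset4_cards3 (T : finType) (p q r s : T) (t : {set T}) :
  #|t| = 3 -> t \subset [set p; q; r; s] ->
  [\/ t = [set p; q; r], t = [set p; q; s], t = [set p; r; s] | t = [set q; r; s]].
Proof.
case/cards3P => x [y [z [xy xz yz ->]]]; rewrite subset3 !inE.
case/and3P; do 3 (case/orP => [/orP[/orP[]|]|] /eqP ?); subst;
  rewrite ?eqxx // in xy xz yz;
  first [ by constructor 1; set_perm | by constructor 2; set_perm
        | by constructor 3; set_perm | by constructor 4; set_perm ].
Qed.

(** Blocks form a [Prop]-valued predicate, so that a construction can list its families as an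
    inductive type; [design_is_S3_46] returns to sets of sets by classical reflection. *)
Definition covered_once (T : finType) (P : {set T} -> Prop) (t : {set T}) :=
  exists b0, [/\ P b0, t \subset b0 & forall b, P b -> t \subset b -> b = b0].

Definition design (T : finType) (P : {set T} -> Prop) :=
  (forall b, P b -> #|b| = 4 \/ #|b| = 6) /\
  (forall t : {set T}, #|t| = 3 -> covered_once P t).

Lemma design_triples (T : finType) (P : {set T} -> Prop) :
  (forall b, P b -> #|b| = 4 \/ #|b| = 6) ->
  (forall x y z, x != y -> x != z -> y != z -> covered_once P [set x; y; z]) ->
  design P.
Proof.
by move=> P46 P1; split=> // t /cards3P [x [y [z [? ? ? ->]]]]; apply: P1.
Qed.

Lemma design_triple (T : finType) (P : {set T} -> Prop) x y z :
  design P -> x != y -> x != z -> y != z ->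
  exists b0, [/\ P b0, [/\ x \in b0, y \in b0 & z \in b0] &
   forall b, P b -> x \in b -> y \in b -> z \in b -> b = b0].
Proof.
case=> _ P1 xy xz yz; have [b0 [Pb0]] := P1 _ (cards3_neq xy xz yz).
rewrite subset3 => /and3P [? ? ?] u; exists b0; split=> // b Pb xb yb zb.
by apply: u => //; rewrite subset3 xb yb zb.
Qed.

Lemma covered_once_intro (T : finType) (P : {set T} -> Prop) x y z b0 :
  P b0 -> x \in b0 -> y \in b0 -> z \in b0 ->
  (forall b, P b -> x \in b -> y \in b -> z \in b -> b = b0) ->
  covered_once P [set x; y; z].
Proof.
move=> Pb0 xb yb zb u; exists b0; split=> //; first by rewrite subset3 xb yb zb.
by move=> b Pb; rewrite subset3 => /and3P [? ? ?]; apply: u.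
Qed.

Definition has_design (T : finType) := exists P : {set T} -> Prop, design P.

Section Transport.
Variables (T T' : finType) (f : T -> T') (g : T' -> T).
Hypotheses (fK : cancel f g) (gK : cancel g f).
Variable P : {set T} -> Prop.

Definition transport_blocks (b : {set T'}) := P (f @^-1: b).

Lemma preimset_fK (b : {set T}) : f @^-1: (g @^-1: b) = b.
Proof. by apply/setP => x; rewrite !inE fK. Qed.

Lemma preimset_gK (b : {set T'}) : g @^-1: (f @^-1: b) = b.
Proof. by apply/setP => x; rewrite !inE gK. Qed.

Lemma card_preimset_f (b : {set T'}) : #|f @^-1: b| = #|b|.
Proof. by apply: on_card_preimset; exists g => ? _; [apply: fK|apply: gK]. Qed.

Lemma subset_preimset_f (t b : {set T'}) :
  (f @^-1: t \subset f @^-1: b) = (t \subset b).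
Proof.
apply/subsetP/subsetP => s x; last by rewrite !inE; apply: s.
by move=> xt; have := s (g x); rewrite !inE gK; apply.
Qed.

Lemma design_transport : design P -> design transport_blocks.
Proof.
case=> P46 P1; split=> [b /P46|t]; first by rewrite card_preimset_f.
rewrite -card_preimset_f => /P1 [b0 [Pb0 tb0 u]].
exists (g @^-1: b0); split.
- by rewrite /transport_blocks preimset_fK.
- by rewrite -subset_preimset_f preimset_fK.
- by move=> b Pb tb; rewrite -(u _ Pb) ?preimset_gK // subset_preimset_f.
Qed.
End Transport.

Lemma card_eq_bij (T T' : finType) : #|T| = #|T'| ->
  exists (f : T -> T') (g : T' -> T), cancel f g /\ cancel g f.
Proof.
move=> e; exists (fun x => enum_val (cast_ord e (enum_rank x))).
exists (fun x => enum_val (cast_ord (esym e) (enum_rank x))).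
by split=> x; rewrite enum_valK (cast_ordK, cast_ordKV) enum_rankK.
Qed.

Lemma has_design_card (T T' : finType) :
  #|T| = #|T'| -> has_design T -> has_design T'.
Proof.
case/card_eq_bij => f [g [fK gK]] [P dP].
by exists (transport_blocks f P); apply: design_transport gK _ dP.
Qed.

Lemma design_is_S3_46 v (P : {set 'I_v} -> Prop) :
  design P -> is_S3_46 [set b | `[< P b >]].
Proof.
case=> P46 P1; apply/andP; split.
  by apply/forall_inP => b; rewrite inE => /asboolP /P46 [] ->.
apply/forall_inP => t /eqP /P1 [b0 [Pb0 tb0 u]].
apply/cards1P; exists b0; apply/setP => b; rewrite !inE.
apply/andP/eqP => [[/asboolP Pb tb]|->]; first exact: u.
by split=> //; apply/asboolP.
Qed.

(** * Doubling *)

(** [F] colours the edges of the complete graph on [W]. By the second clause every colour of an edge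
    reaches every vertex, by the third the colouring is proper; the diagonal of [F] is left free. *)
Definition onefact (W K : finType) (F : W -> W -> K) :=
  [/\ forall x y, F x y = F y x,
      forall x y z, x != y -> exists w, w != z /\ F z w = F x y
    & forall x y z, y != x -> z != x -> F x y = F x z -> y = z].

Section Doubling.
Variables (W K : finType) (F : W -> W -> K) (P : {set W} -> Prop).
Hypotheses (oF : onefact F) (dP : design P).

Inductive double_blocks : {set W * bool} -> Prop :=
| DoubleLayer i b of P b : double_blocks [set p | (p.2 == i) && (p.1 \in b)]
| DoubleCross z z' w w' of z != z' & w != w' & F z z' = F w w' :
    double_blocks [set (z, false); (z', false); (w, true); (w', true)].

Lemma card_layer (b : {set W}) i :
  #|[set p : W * bool | (p.2 == i) && (p.1 \in b)]| = #|b|.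
Proof.
rewrite -(card_imset b (f := fun x => (x, i))) => [|x y [] //].
congr (#|pred_of_set _|); apply/setP => -[x j]; rewrite !inE /=.
apply/andP/imsetP => [[/eqP -> xb]|[y yb [-> ->]]]; first by exists x.
by rewrite eqxx.
Qed.

Lemma onefact_pair z z' p p' : z != z' ->
  (z == p) || (z == p') -> (z' == p) || (z' == p') ->
  F z z' = F p p' /\ forall x, (x == p) || (x == p') = (x == z) || (x == z').
Proof.
move=> zz; do 2 (case/orP => /eqP ?); subst; rewrite ?eqxx // in zz *.
by split=> [|x]; [case: oF | rewrite orbC].
Qed.

Lemma onefact_other w q q' u : w != u -> q != q' -> (w == q) || (w == q') ->
  F q q' = F w u -> forall x, (x == q) || (x == q') = (x == w) || (x == u).
Proof.
case: oF => sF eF uF wu qq /orP [/eqP e|/eqP e] ff x; subst.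
  by rewrite (uF _ _ _ _ _ ff) 1?eq_sym.
by rewrite sF in ff; rewrite orbC (uF _ _ _ _ _ ff) 1?eq_sym // eq_sym.
Qed.

(** The pair [z z'] names a factor, which matches [w] to exactly one [w']. Cross blocks are listed
    with layer [false] first, hence two symmetric cases on [i]. *)
Lemma double_cross_covered i z z' w : z != z' ->
  covered_once double_blocks [set (z, i); (z', i); (w, ~~ i)].
Proof.
move=> zz; case: (oF) => sF eF uF; have [w' [ww fw]] := eF _ _ w zz.
case: i => /=.
  apply: (@covered_once_intro _ _ _ _ _
    [set (w, false); (w', false); (z, true); (z', true)]);
    rewrite ?inE ?eqxx ?orbT //; first by apply: DoubleCross; rewrite // eq_sym.
  move=> _ [j b Pb|p p' q q' pp qq pq]; rewrite !inE ?xpair_eqE ?andbF ?andbT ?orbF /=.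
    by case: j.
  move=> zq zq' wp; apply/setP => -[x j]; rewrite !inE !xpair_eqE.
  have [e1 e2] := onefact_pair zz zq zq'.
  have e3 := onefact_other (u := w') _ pp wp _.
  case: j; rewrite ?andbF ?andbT ?orbF /=; first exact: e2.
  by apply: e3; rewrite 1?eq_sym // fw e1.
apply: (@covered_once_intro _ _ _ _ _
  [set (z, false); (z', false); (w, true); (w', true)]);
  rewrite ?inE ?eqxx ?orbT //; first by apply: DoubleCross; rewrite // eq_sym.
move=> _ [j b Pb|p p' q q' pp qq pq]; rewrite !inE ?xpair_eqE ?andbF ?andbT ?orbF /=.
  by case: j.
move=> zp zp' wq; apply/setP => -[x j]; rewrite !inE !xpair_eqE.
have [e1 e2] := onefact_pair zz zp zp'.
have e3 := onefact_other (u := w') _ qq wq _.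
case: j; rewrite ?andbF ?andbT ?orbF /=; last exact: e2.
by apply: e3; rewrite 1?eq_sym // fw e1.
Qed.

Lemma double_layer_covered i x y z : x != y -> x != z -> y != z ->
  covered_once double_blocks [set (x, i); (y, i); (z, i)].
Proof.
move=> xy xz yz; have [b0 [Pb0 [xb yb zb] u]] := design_triple dP xy xz yz.
apply: (@covered_once_intro _ _ _ _ _ [set p | (p.2 == i) && (p.1 \in b0)]);
  rewrite ?inE ?eqxx //; first exact: DoubleLayer.
move=> _ [j b Pb|p p' q q' pp qq pq]; rewrite !inE ?xpair_eqE /=.
  case: eqP => // <- *; apply/setP => p; rewrite !inE.
  by rewrite (u b).
case: i; rewrite ?andbF ?andbT ?orbF /=;
  do 3 (case/orP => /eqP ?); subst; by rewrite ?eqxx in xy xz yz.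
Qed.

Lemma design_double : design double_blocks.
Proof.
apply: design_triples => [_ [i b Pb|z z' w w' zz ww _]|].
- by rewrite card_layer; apply: dP.1.
- by left; rewrite cards4_neq // xpair_eqE ?eqxx ?andbF ?andbT.
move=> [x i] [y j] [z k]; rewrite !xpair_eqE.
have [<-{j} xy|ij] := eqVneq i j.
  rewrite andbT in xy; have [<-{k} |ik _ _] := eqVneq i k.
    by rewrite !andbT; apply: double_layer_covered.
  by rewrite (_ : k = ~~ i); [apply: double_cross_covered | case: i k ik => -[]].
have [<-{k} _|ik] := eqVneq i k.
  rewrite andbT => xz _; rewrite set3CA (_ : j = ~~ i).
    exact: double_cross_covered.
  by case: i j ij => -[].
have -> : k = j by case: i j k ij ik => -[] [].
rewrite eqxx andbT => _ _ yz; rewrite set3C set3CA (_ : i = ~~ j).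
  exact: double_cross_covered.
by case: i j ij {ik} => -[].
Qed.
End Doubling.

(** * Orders 4m - 2 *)

(** [mate a x] is the neighbour of [x] in the factor of colour [a], so there is one colour fewer
    than vertices, and two copies of both give 4|W| - 2 points. The idempotent commutative
    quasigroup [op] assigns a factor to each pair of colours. *)
Section QuadrupleMinus.
Variables (K W : finType) (c : W -> W -> K) (mate : K -> W -> W).
Hypotheses (cC : forall x y, c x y = c y x)
  (mate_neq : forall a x, mate a x != x)
  (c_mate : forall a x, c x (mate a x) = a)
  (mate_c : forall x y, x != y -> mate (c x y) x = y).
Variables (op ldiv : K -> K -> K).
Hypotheses (opC : forall a b, op a b = op b a) (opxx : forall a, op a a = a)
  (op_ldiv : forall a b, op a (ldiv a b) = b)
  (ldiv_op : forall a b, ldiv a (op a b) = b).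
Variables (P : {set K * bool} -> Prop) (D : {set W} -> Prop).
Hypotheses (dP : design P) (dD : design D).

Let T : finType := ((K + W) * bool)%type.
Notation A a i := ((inl a, i) : T).
Notation Z z i := ((inr z, i) : T).

Definition colour_set (d : {set K * bool}) : {set T} :=
  [set p : T | if p is (inl a, i) then (a, i) \in d else false].
Definition vertex_set i (d : {set W}) : {set T} :=
  [set p : T | if p is (inr z, j) then (j == i) && (z \in d) else false].
(** Both copies of an edge and of its colour. These blocks absorb the triples on which the three
    families of quadruples degenerate. *)
Definition six (z z' : W) : {set T} :=
  [set p : T | if p.1 is inr x then (x == z) || (x == z') else p.1 == inl (c z z')].
Definition four_zz i z z' w w' := [set Z z i; Z z' i; Z w (~~ i); Z w' (~~ i)].
Definition four_aa i j a b z w := [set A a i; A b i; Z z j; Z w j].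
Definition four_az i a z b w := [set A a i; Z z i; A b (~~ i); Z w (~~ i)].

(* The colours of the factorization are points too: [A a i] and [Z z i] are the
   [i]-th copies of the colour [a] and of the vertex [z]. *)
Inductive quad_blocks : {set T} -> Prop :=
| QuadColours d of P d : quad_blocks (colour_set d)
| QuadVertices i d of D d : quad_blocks (vertex_set i d)
| QuadSix z z' of z != z' : quad_blocks (six z z')
| QuadZZ i z z' w w' of z != z' & w != w' & c z z' = c w w' & w != z & w != z' :
    quad_blocks (four_zz i z z' w w')
| QuadAA i j a b z w of a != b & z != w & op a b = c z w :
    quad_blocks (four_aa i j a b z w)
| QuadAZ i a z b w of z != w & mate a z = mate b w :
    quad_blocks (four_az i a z b w).

Lemma mateK a x : mate a (mate a x) = x.
Proof. by rewrite -{1}(c_mate a x) cC mate_c. Qed.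

Lemma c_inj x y z : y != x -> z != x -> c x y = c x z -> y = z.
Proof. by move=> yx zx e; rewrite -(@mate_c x y) 1?eq_sym // e mate_c // eq_sym. Qed.

Lemma AAE a b i j : (A a i == A b j) = (a == b) && (i == j).
Proof. by []. Qed.
Lemma AZE a b i j : (A a i == Z b j) = false. Proof. by []. Qed.
Lemma ZAE a b i j : (Z b j == A a i) = false. Proof. by []. Qed.
Lemma ZZE a b i j : (Z a i == Z b j) = (a == b) && (i == j).
Proof. by []. Qed.
Lemma negb_eqF (i : bool) : (i == ~~ i) = false. Proof. by case: i. Qed.
Lemma negb_eqF' (i : bool) : (~~ i == i) = false. Proof. by case: i. Qed.
Definition ptE := (AAE, AZE, ZAE, ZZE, negb_eqF, negb_eqF', eqxx, andbT, andbF, orbF, orbT).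

Lemma sixC z z' : six z z' = six z' z.
Proof. by apply/setP => -[[a|x] i]; rewrite !inE /= 1?cC // orbC. Qed.

Lemma four_zzC i z z' w w' : four_zz i z z' w w' = four_zz i z' z w w'.
Proof. by rewrite /four_zz; set_perm. Qed.
Lemma four_zzC' i z z' w w' : four_zz i z z' w w' = four_zz i z z' w' w.
Proof. by rewrite /four_zz; set_perm. Qed.
Lemma four_zzN i z z' w w' : four_zz (~~ i) z z' w w' = four_zz i w w' z z'.
Proof. by rewrite /four_zz negbK; set_perm. Qed.
Lemma four_aaC i j a b z w : four_aa i j a b z w = four_aa i j b a z w.
Proof. by rewrite /four_aa; set_perm. Qed.
Lemma four_aaC' i j a b z w : four_aa i j a b z w = four_aa i j a b w z.
Proof. by rewrite /four_aa; set_perm. Qed.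
Lemma four_azN i a z b w : four_az (~~ i) a z b w = four_az i b w a z.
Proof. by rewrite /four_az negbK; set_perm. Qed.

(** Whatever place the point has in its constructor, the block is rewritten to start from this
    point, with only free parameters left. The covering lemmas read uniqueness off these forms. *)
Lemma quad_colour_inv b a i : quad_blocks b -> A a i \in b ->
  [\/ exists2 d, P d & b = colour_set d,
      exists z, b = six z (mate a z),
      exists a' j z, a' != a /\ b = four_aa i j a a' z (mate (op a a') z)
    | exists z w, [/\ w != z, w != mate a z &
        b = four_az i a z (c w (mate a z)) w]].
Proof.
case=> [d Pd|j d Dd|z z' zz|j z z' w w' zz ww zw w1 w2|k j x y z w xy zw e|j x z y w zw e];
  rewrite !inE ?ptE //=.
- by constructor 1; exists d.
- by rewrite -[_ == _]/(a == _) => /eqP ->; constructor 2; exists z; rewrite mate_c.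
- case/orP => /andP [/eqP ? /eqP ?]; subst; constructor 3.
    by exists y, j, z; rewrite eq_sym e mate_c.
  by exists x, j, z; rewrite four_aaC opC e mate_c.
- have wm : w != mate x z by apply/eqP => h; have := mate_neq y w; rewrite -e h eqxx.
  have zm : z != mate y w by rewrite -e eq_sym.
  case/orP => /andP [/eqP ? /eqP ?]; subst; constructor 4.
    by exists z, w; rewrite eq_sym wm e c_mate.
  by exists w, z; rewrite zm -e c_mate four_azN.
Qed.

Lemma quad_vertex_inv b z i : quad_blocks b -> Z z i \in b ->
  [\/ exists2 d, D d & b = vertex_set i d,
      exists a, b = six z (mate a z),
      exists z' w, [/\ z' != z, w != z, w != z' &
        b = four_zz i z z' w (mate (c z z') w)]
    | (exists a a' j, a' != a /\ b = four_aa j i a a' z (mate (op a a') z)) \/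
      (exists a w, [/\ w != z, w != mate a z &
        b = four_az i a z (c w (mate a z)) w])].
Proof.
case=> [d Pd|j d Dd|x x' xx|j x x' w w' xx ww xw w1 w2|k j x y x' w xy zw e|j x x' y w zw e];
  rewrite !inE ?ptE //=.
- by case/andP => /eqP -> _; constructor 1; exists d.
- case/orP => /eqP ->; constructor 2; exists (c x x'); first by rewrite mate_c.
  by rewrite sixC [c x _]cC mate_c // eq_sym.
(* Edges of one colour that share a vertex coincide, so [w'] avoids the edge [x x'] because [w]
   does. *)
- have wx : w' != x.
    apply: contra w2 => /eqP e; subst.
    by apply/eqP; apply: (@c_inj x); rewrite // 1?eq_sym // cC -xw.
  have wx' : w' != x'.
    apply: contra w1 => /eqP e; subst.
    by apply/eqP; apply: (@c_inj x'); rewrite // cC -xw cC.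
  case/orP => [/orP [/orP []|]|] /andP [/eqP ? /eqP ?]; subst; constructor 3.
  + by exists x', w; rewrite eq_sym w1 w2 xw mate_c.
  + by exists x, w; rewrite four_zzC w1 w2 cC xw mate_c.
  + exists w', x; rewrite four_zzN 2![x == _]eq_sym eq_sym.
    by rewrite w1 ww wx -xw mate_c.
  + exists w, x; rewrite four_zzN 2![x == _]eq_sym [c w' w]cC -xw mate_c //.
    by rewrite ww w1 wx four_zzC'; split.
- case/orP => /andP [/eqP ? /eqP ?]; subst; constructor 4; left.
    by exists x, y, k; rewrite eq_sym e mate_c.
  exists x, y, k; split; first by rewrite eq_sym.
  by rewrite e cC mate_c 1?eq_sym // four_aaC'.
- have wm : w != mate x x' by apply/eqP => h; have := mate_neq y w; rewrite -e h eqxx.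
  have zm : x' != mate y w by rewrite -e eq_sym.
  case/orP => /andP [/eqP ? /eqP ?]; subst; constructor 4; right.
    by exists x, w; rewrite eq_sym wm e c_mate.
  by exists y, x'; rewrite zm -e c_mate four_azN.
Qed.

Lemma card_six z z' : z != z' -> #|six z z'| = 6.
Proof.
move=> zz; set a := c z z'.
have -> : six z z' = setX [set inl a; inr z; inr z'] [set: bool].
  by apply/setP => -[[x|x] i]; rewrite !inE andbT //=; case: (inl x == _).
by rewrite cardsX cards3_neq // cardsT card_bool.
Qed.

Lemma quad_blocks_card b : quad_blocks b -> #|b| = 4 \/ #|b| = 6.
Proof.
case=> [d Pd|i d Dd|z z' zz|i z z' w w' zz ww zw w1 w2|i j x y z w xy zw e|i x z y w zw e].
- have <- : #|d| = #|colour_set d| by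
    rewrite -(card_imset d (f := fun x => (inl x.1, x.2) : T)) => [|[x i] [y j] [-> ->] //];
    congr (#|pred_of_set _|); apply/setP => -[[x|x] j]; rewrite inE;
      [apply/imsetP/idP => [[[y k] yd [-> ->]] //|xd]; exists (x, j)
      |apply/imsetP => -[]].
  exact: dP.1.
- have <- : #|d| = #|vertex_set i d| by
    rewrite -(card_imset d (f := fun x => Z x i)) => [|x y [] //];
    congr (#|pred_of_set _|); apply/setP => -[[x|x] j]; rewrite inE;
      [apply/imsetP => -[]
      |apply/imsetP/andP => [[y yd [-> ->]] //|[/eqP -> xd]]; exists x].
  exact: dD.1.
- by right; apply: card_six.
- by left; rewrite cards4_neq ?ptE.
- by left; rewrite cards4_neq ?ptE.
- by left; rewrite cards4_neq ?ptE.
Qed.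

Lemma quad_covered_aab i j a b z : a != b ->
  covered_once quad_blocks [set A a i; A b i; Z z j].
Proof.
move=> ab; set w := mate (op a b) z.
apply: (@covered_once_intro _ _ _ _ _ (four_aa i j a b z w)); rewrite ?inE ?eqxx ?orbT //.
  by apply: QuadAA; rewrite ?c_mate // eq_sym mate_neq.
move=> e /quad_colour_inv q /q {q} [[d _ ->]|[x ->]|[a' [k [x [aa ->]]]]|[x [y [_ _ ->]]]];
  rewrite !inE ?ptE //=.
- by rewrite c_mate -[_ == _]/(b == a) eq_sym (negPf ab).
- rewrite [b == a]eq_sym (negPf ab) /= => /eqP ?; subst.
  case/orP => /andP [/eqP ? /eqP ?]; subst=> //.
  by rewrite /w mateK four_aaC'.
- by rewrite [b == a]eq_sym (negPf ab).
Qed.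

(** The fourth point solves [mate b w = mate a z]. As [mate b] is an involution there is one
    solution, and it differs from [z] unless [a = b], when a block of size six takes over. *)
Lemma quad_covered_abz i a b z :
  covered_once quad_blocks [set A a i; A b (~~ i); Z z i].
Proof.
have [<-{b}|ab] := eqVneq a b.
  apply: (@covered_once_intro _ _ _ _ _ (six z (mate a z)));
    rewrite ?inE /= ?c_mate ?eqxx //.
    by apply: QuadSix; rewrite eq_sym mate_neq.
  move=> e /quad_colour_inv q /q {q} [[d _ ->]|[x ->]|[a' [k [x [aa ->]]]]|[x [y [yx ym ->]]]];
    rewrite !inE ?ptE //=.
  - by move=> _ /orP [/eqP ->|/eqP ->] //; rewrite mateK sixC.
  - move=> /eqP h; case/eqP: yx; apply: (@c_inj (mate a x)) => //.
      by rewrite eq_sym mate_neq.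
    by rewrite !(cC (mate a x)) c_mate.
set w := mate b (mate a z).
have zw : z != w by apply: contra ab => /eqP h; rewrite -(c_mate a z) {1}h cC c_mate.
apply: (@covered_once_intro _ _ _ _ _ (four_az i a z b w)); rewrite ?inE ?eqxx ?orbT //.
  by apply: QuadAZ; rewrite // mateK.
move=> e /quad_colour_inv q /q {q} [[d _ ->]|[x ->]|[a' [k [x [aa ->]]]]|[x [y [yx ym ->]]]];
  rewrite !inE ?ptE //=.
- by rewrite c_mate -[_ == _]/(b == a) eq_sym (negPf ab).
- by move=> /eqP hb /eqP hz; rewrite /w hz hb (cC y) mate_c // eq_sym.
Qed.

(** The edge [z w] is completed by the colour [b] with [op a b = c z w]. By idempotency [b = a]
    exactly when [a] is the colour of the edge, and then the block is [six z w]. *)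
Lemma quad_covered_azz i j a z w : z != w ->
  covered_once quad_blocks [set A a i; Z z j; Z w j].
Proof.
move=> zw; have [ea|ne] := eqVneq (c z w) a.
  apply: (@covered_once_intro _ _ _ _ _ (six z w)); rewrite ?inE /= ?ea ?eqxx ?orbT //.
    exact: QuadSix.
  move=> e /quad_colour_inv q /q {q} [[d _ ->]|[x ->]|[a' [k [x [aa ->]]]]|[x [y [yx ym ->]]]];
    rewrite !inE ?ptE //=.
  - case/orP => /eqP hz; case/orP => /eqP hw; move: zw; rewrite hz hw ?eqxx // => _.
    exact: sixC.
  - move=> h1 h2; suff h : op a a' = a.
      by move: aa; rewrite -(ldiv_op a a') h -{2}(opxx a) ldiv_op eqxx.
    case/orP: h1 => /andP [/eqP hz _]; case/orP: h2 => /andP [/eqP hw _];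
      move: zw; rewrite -{2}ea hz hw ?eqxx // => _.
    by rewrite cC c_mate.
  - case: (j) (i) => -[]; rewrite ?andbF ?andbT //= ?orbF => /eqP ? /eqP ?; subst;
    by rewrite eqxx in zw.
set b := ldiv a (c z w).
have ab : a != b by apply: contra ne => /eqP h; rewrite -(op_ldiv a (c z w)) -/b -h opxx.
apply: (@covered_once_intro _ _ _ _ _ (four_aa i j a b z w)); rewrite ?inE ?eqxx ?orbT //.
  by apply: QuadAA; rewrite // op_ldiv.
move=> e /quad_colour_inv q /q {q} [[d _ ->]|[x ->]|[a' [k [x [aa ->]]]]|[x [y [yx ym ->]]]];
  rewrite !inE ?ptE //=.
- do 2 case/orP => /eqP ?; subst; rewrite ?eqxx // in zw.
    by rewrite c_mate eqxx in ne.
  by rewrite cC c_mate eqxx in ne.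
- do 2 case/orP => /andP [/eqP ? /eqP ?]; subst; rewrite ?eqxx // in zw.
    by rewrite /b c_mate ldiv_op.
  by rewrite /b cC c_mate ldiv_op four_aaC'.
- case: (j) (i) => -[]; rewrite ?andbF ?andbT //= ?orbF => /eqP ? /eqP ?; subst;
  by rewrite eqxx in zw.
Qed.

(** The missing colour is that of the edge from [w] to [mate a z]. There is no such edge for
    [w = mate a z], and [w = z] would return [a]; both cases belong to [six z (mate a z)]. *)
Lemma quad_covered_azw i a z w :
  covered_once quad_blocks [set A a i; Z z i; Z w (~~ i)].
Proof.
have [h|] := boolP ((w == z) || (w == mate a z)).
  apply: (@covered_once_intro _ _ _ _ _ (six z (mate a z)));
    rewrite ?inE /= ?c_mate ?eqxx //.
    by apply: QuadSix; rewrite eq_sym mate_neq.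
  move=> e /quad_colour_inv q /q {q} [[d _ ->]|[x ->]|[a' [k [x [aa ->]]]]|[x [y [yx ym ->]]]];
    rewrite !inE ?ptE //=.
  - by move=> /orP [/eqP ->|/eqP ->] // _; rewrite mateK sixC.
  - by case: (i) (k) => -[]; rewrite ?andbF.
  - by move=> /eqP ? /eqP ?; subst; rewrite (negPf yx) (negPf ym) in h.
rewrite negb_or => /andP [wz wm].
apply: (@covered_once_intro _ _ _ _ _ (four_az i a z (c w (mate a z)) w));
  rewrite ?inE ?eqxx ?orbT //.
  by apply: QuadAZ; rewrite 1?eq_sym // mate_c.
move=> e /quad_colour_inv q /q {q} [[d _ ->]|[x ->]|[a' [k [x [aa ->]]]]|[x [y [yx ym ->]]]];
  rewrite !inE ?ptE //=.
- do 2 case/orP => /eqP ?; subst; rewrite ?mateK ?eqxx // in wz wm.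
- by case: (i) (k) => -[]; rewrite ?andbF.
- by move=> /eqP -> /eqP ->.
Qed.

Lemma quad_covered_zzw i z z' w : z != z' ->
  covered_once quad_blocks [set Z z i; Z z' i; Z w (~~ i)].
Proof.
move=> zz; have [h|] := boolP ((w == z) || (w == z')).
  apply: (@covered_once_intro _ _ _ _ _ (six z z')); rewrite ?inE /= ?eqxx ?orbT //.
    exact: QuadSix.
  move=> e /quad_vertex_inv q /q {q} [[d _ ->]|[x ->]|[x [y [xz yz yx ->]]]
    |[[a [b [j [ab ->]]]]|[a [y [yz ym ->]]]]];
    rewrite !inE ?ptE //=.
  - by rewrite [z' == z]eq_sym (negPf zz) /= => /eqP -> _.
  - rewrite [z' == z]eq_sym (negPf zz) /= => /eqP ?; subst.
    case/orP => /eqP ?; subst; first by rewrite (negPf yz) (negPf yx) in h.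
    case/orP: h => /eqP h; move: (yx) (yz); rewrite -(mateK (c z x) y) h.
      by rewrite mate_c ?eqxx // eq_sym.
    by rewrite cC mate_c ?eqxx // eq_sym.
  - by move=> /eqP h'; rewrite h' eqxx in zz.
rewrite negb_or => /andP [wz wz'].
apply: (@covered_once_intro _ _ _ _ _ (four_zz i z z' w (mate (c z z') w)));
  rewrite ?inE ?eqxx ?orbT //.
  by apply: QuadZZ; rewrite ?c_mate // eq_sym mate_neq.
move=> e /quad_vertex_inv q /q {q} [[d _ ->]|[x ->]|[x [y [xz yz yx ->]]]
    |[[a [b [j [ab ->]]]]|[a [y [yz ym ->]]]]];
  rewrite !inE ?ptE //=.
- rewrite [z' == z]eq_sym (negPf zz) (negPf wz) /= => /eqP h.
  by rewrite -h (negPf wz').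
- rewrite [z' == z]eq_sym (negPf zz) /= => /eqP ?; subst.
  by case/orP => /eqP ->; rewrite ?mateK // four_zzC'.
- by move=> /eqP h'; rewrite h' eqxx in zz.
Qed.

Lemma quad_covered_zzz i x y z : x != y -> x != z -> y != z ->
  covered_once quad_blocks [set Z x i; Z y i; Z z i].
Proof.
move=> xy xz yz; have [d0 [Dd0 [xd yd zd] u]] := design_triple dD xy xz yz.
apply: (@covered_once_intro _ _ _ _ _ (vertex_set i d0)); rewrite ?inE ?eqxx //.
  exact: QuadVertices.
move=> _ [d Pd|j d Dd|p p' pp|j p p' q q' pp qq pq w1 w2|k j a b p q ab pq e|j a p b q pq e];
  rewrite !inE ?ptE //=.
- by case: eqP => //= <- ? ? ?; rewrite (u d).
- by do 3 (case/orP => /eqP ?); subst; rewrite ?eqxx in xy xz yz.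
- case: (i) (j) => -[]; rewrite ?andbF ?andbT //= ?orbF;
  by do 3 (case/orP => /eqP ?); subst; rewrite ?eqxx in xy xz yz.
- by do 3 (case/orP => /andP [/eqP ? _]); subst; rewrite ?eqxx in xy xz yz.
- case: (i) (j) => -[]; rewrite ?andbF ?andbT //= ?orbF;
  by do 3 (move=> /eqP ?); subst; rewrite ?eqxx in xy xz yz.
Qed.

Lemma quad_covered_aaa a b d i j k : (a, i) != (b, j) -> (a, i) != (d, k) ->
  (b, j) != (d, k) -> covered_once quad_blocks [set A a i; A b j; A d k].
Proof.
move=> ab ad bd; have [s0 [Ps0 [as_ bs ds] u]] := design_triple dP ab ad bd.
apply: (@covered_once_intro _ _ _ _ _ (colour_set s0)); rewrite ?inE //.
  exact: QuadColours.
move=> _ [s Ps|l s Ds|p p' pp|l p p' q q' pp qq pq w1 w2|l l' x y p q xy pq e|l x p y q pq e];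
  rewrite !inE ?ptE //=.
- by move=> ? ? ?; rewrite (u s).
- move=> /eqP [?] /eqP [?] /eqP [?]; subst.
  by move: ab ad bd; rewrite !xpair_eqE !eqxx; case: (i) (j) (k) => -[] [].
- by do 3 (case/orP => /andP [/eqP ? /eqP ?]); subst; rewrite ?eqxx in ab ad bd.
- by do 3 (case/orP => /andP [/eqP ? /eqP ?]); subst; rewrite ?eqxx in ab ad bd.
Qed.

Lemma negb_neq (i j : bool) : i != j -> j = ~~ i.
Proof. by case: i j => -[]. Qed.

Lemma quad_covered_aaz a b z i j k : A a i != A b j ->
  covered_once quad_blocks [set A a i; A b j; Z z k].
Proof.
rewrite AAE; have [<-{j}|ij _] := eqVneq i j.
  by rewrite andbT; apply: quad_covered_aab.
rewrite (negb_neq ij); have [<-{k}|/negb_neq ->] := eqVneq i k.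
  exact: quad_covered_abz.
by rewrite set3C -{2}(negbK i); apply: quad_covered_abz.
Qed.

Lemma quad_covered_azz_gen a z w i j k : Z z j != Z w k ->
  covered_once quad_blocks [set A a i; Z z j; Z w k].
Proof.
rewrite ZZE; have [<-{k}|jk _] := eqVneq j k.
  by rewrite andbT; apply: quad_covered_azz.
have [->|ik] := eqVneq i j; first by rewrite (negb_neq jk); apply: quad_covered_azw.
have -> : k = i by case: i j k jk ik => -[] [].
by rewrite (negb_neq ik) set3CA; apply: quad_covered_azw.
Qed.

Lemma quad_covered_zzz_gen x y z i j k : Z x i != Z y j -> Z x i != Z z k ->
  Z y j != Z z k -> covered_once quad_blocks [set Z x i; Z y j; Z z k].
Proof.
rewrite !ZZE; have [<-{j}|ij _] := eqVneq i j.
  rewrite andbT => xy; have [<-{k}|ik _ _] := eqVneq i k.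
    by rewrite !andbT; apply: quad_covered_zzz.
  by rewrite (negb_neq ik); apply: quad_covered_zzw.
have [<-{k}|ik _] := eqVneq i k.
  by rewrite andbT (negb_neq ij) set3CA => xz _; apply: quad_covered_zzw.
have -> : k = j by case: i j k ij ik => -[] [].
rewrite eqxx andbT => yz; rewrite set3C set3CA.
by rewrite eq_sym in ij; rewrite (negb_neq ij); apply: quad_covered_zzw.
Qed.

Lemma design_quad : design quad_blocks.
Proof.
apply: design_triples; first exact: quad_blocks_card.
move=> [[a|x] i] [[b|y] j] [[d|z] k] xy xz yz.
- exact: quad_covered_aaa.
- exact: quad_covered_aaz.
- by rewrite set3CA; apply: quad_covered_aaz.
- exact: quad_covered_azz_gen.
- by rewrite set3C set3CA; apply: quad_covered_aaz.
- by rewrite set3C; apply: quad_covered_azz_gen.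
- by rewrite set3CA set3C; apply: quad_covered_azz_gen.
- exact: quad_covered_zzz_gen.
Qed.
End QuadrupleMinus.

(** * Orders 4g + 2 *)

(* [R] is the ring of integers modulo an even [g], [par] the parity, and [eps]
   separates [x] from [x + g/2]. The pairs [{r, s}] with [r + s = e] form a perfect
   matching when [e] is odd, and miss [c] and [c + g/2] when [e = 2c]; in the latter
   case the missed points are joined to the two points [I l] of the stem. *)
Section QuadruplePlus.
Variables (R : finComNzRingType) (par eps : R -> bool) (half : R -> bool -> R).
Local Open Scope ring_scope.
Hypotheses (parD : forall x y, par (x + y) = par x (+) par y) (par1 : par 1 = true)
  (double_half : forall e b, par e = false -> half e b + half e b = e)
  (eps_half : forall e b, eps (half e b) = b)
  (double_inj : forall x y, x + x = y + y -> eps x = eps y -> x = y).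
Variables (K : finType) (F : R -> R -> K) (D : {set bool + R} -> Prop).
Hypotheses (oF : onefact F) (dD : design D).

Let T : finType := (bool + bool * bool * R)%type.
Notation I l := (inl l : T).
Notation G h i x := (inr (h, i, x) : T).

Definition stem_set h i (d : {set bool + R}) : {set T} :=
  [set p : T | match p with
   | inl l => inl l \in d
   | inr (h', i', x) => [&& h' == h, i' == i & inr x \in d] end].
Definition four_C h i x x' y y' := [set G h i x; G h i x'; G h (~~ i) y; G h (~~ i) y'].
(** The points [x] and [y], one in each layer of the half [h], select a matching [r + s = e] on a
    layer [j] of the other half. In [PlusA] the parity of [e] is [j (+) eps x (+) eps y]. *)
Definition four_A h i j x y r s := [set G h i x; G h (~~ i) y; G (~~ h) j r; G (~~ h) j s].
(** The two points missed by an even matching differ in [eps], so they get different stem points.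
    The choice is compatible with exchanging the layers ([four_BN]) and is negated by exchanging the
    halves ([stem_indexN]). *)
Definition stem_index h i j x z := eps z (+) eps x (+) (i && j) (+) h.
Definition four_B h i j x y z :=
  [set I (stem_index h i j x z); G h i x; G h (~~ i) y; G (~~ h) j z].
Definition bit (b : bool) : R := b%:R.

Inductive plus_blocks : {set T} -> Prop :=
| PlusStem h i d of D d : plus_blocks (stem_set h i d)
| PlusC h i x x' y y' of x != x' & y != y' & F x x' = F y y' :
    plus_blocks (four_C h i x x' y y')
| PlusA h i j x y r s of r != s &
    x + x + (y + y) + (r + s) = bit (j (+) eps x (+) eps y) :
    plus_blocks (four_A h i j x y r s)
| PlusB h i j x y z of j = eps x (+) eps y & x + x + (y + y) + (z + z) = 0 :
    plus_blocks (four_B h i j x y z).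

Lemma par0 : par 0 = false.
Proof. by have := parD 0 0; rewrite addr0; case: (par 0). Qed.

Lemma par_double x : par (x + x) = false.
Proof. by rewrite parD addbb. Qed.

Lemma parN x : par (- x) = par x.
Proof. by have := parD x (- x); rewrite subrr par0; case: (par x); case: (par _). Qed.

Lemma par_bit b : par (bit b) = b.
Proof. by case: b; [exact: par1 | exact: par0]. Qed.

Lemma IIE l l' : (I l == I l') = (l == l'). Proof. by []. Qed.
Lemma IGE l h i x : (I l == G h i x) = false. Proof. by []. Qed.
Lemma GIE l h i x : (G h i x == I l) = false. Proof. by []. Qed.
Lemma GGE h i x h' i' x' :
  (G h i x == G h' i' x') = (h == h') && (i == i') && (x == x').
Proof. by []. Qed.
Definition plusE := (IIE, IGE, GIE, GGE, negb_eqF, negb_eqF', eqxx, andbT, andbF, orbF, orbT).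

Lemma four_CN h i x x' y y' : four_C h (~~ i) x x' y y' = four_C h i y y' x x'.
Proof. by rewrite /four_C negbK; set_perm. Qed.
Lemma four_CC h i x x' y y' : four_C h i x x' y y' = four_C h i x' x y y'.
Proof. by rewrite /four_C; set_perm. Qed.
Lemma four_CC' h i x x' y y' : four_C h i x x' y y' = four_C h i x x' y' y.
Proof. by rewrite /four_C; set_perm. Qed.
Lemma four_AN h i j x y r s : four_A h (~~ i) j x y r s = four_A h i j y x r s.
Proof. by rewrite /four_A negbK; set_perm. Qed.
Lemma four_AC h i j x y r s : four_A h i j x y r s = four_A h i j x y s r.
Proof. by rewrite /four_A; set_perm. Qed.
Lemma four_BN h i x y z j : j = eps x (+) eps y ->
  four_B h (~~ i) j x y z = four_B h i j y x z.
Proof.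
move=> ej; rewrite /four_B negbK.
have -> : stem_index h (~~ i) j x z = stem_index h i j y z.
  rewrite /stem_index ej.
  by case: (i); case: (eps x); case: (eps y); case: (eps z); case: (h).
by set_perm.
Qed.

(** In [four_A] and [four_B] the given point lies either in the half that selects the matching or in
    the half that is matched, hence two subcases for each. *)
Lemma plus_inv b h i x : plus_blocks b -> G h i x \in b ->
  [\/ exists2 d, D d & b = stem_set h i d,
      exists x' y y', [/\ x != x', y != y', F x x' = F y y' &
        b = four_C h i x x' y y'],
      (exists j y r s, [/\ r != s,
        x + x + (y + y) + (r + s) = bit (j (+) eps x (+) eps y) &
        b = four_A h i j x y r s]) \/
      (exists k a c s, [/\ x != s,
        a + a + (c + c) + (x + s) = bit (i (+) eps a (+) eps c) &
        b = four_A (~~ h) k i a c x s])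
    | (exists j y z, [/\ j = eps x (+) eps y, x + x + (y + y) + (z + z) = 0 &
        b = four_B h i j x y z]) \/
      (exists k a c, [/\ i = eps a (+) eps c, a + a + (c + c) + (x + x) = 0 &
        b = four_B (~~ h) k i a c x])].
Proof.
have xorCA (a b' c : bool) : a (+) b' (+) c = a (+) c (+) b' by case: a b' c => -[] [].
case=> [h' i' d Dd|h' i' p p' q q' pp qq e|h' i' j p q r s rs e|h' i' j p q z ej e];
  rewrite !inE ?plusE //=.
- by case/and3P => /eqP -> /eqP -> _; constructor 1; exists d.
- have [<-{h'}|_] := eqVneq h h'; rewrite //= => hx; constructor 2.
  case/orP: hx => [/orP [/orP []|]|] /andP [/eqP ? /eqP ?]; subst.
  + by exists p', q, q'.
  + by exists p, q, q'; rewrite four_CC eq_sym; case: oF => -> _ _.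
  + by exists q', p, p'; rewrite four_CN.
  + by exists q, p, p'; rewrite four_CN four_CC' eq_sym; case: oF => ->.
- case/orP => [/orP [/orP []|]|] /andP [/andP [/eqP ? /eqP ?] /eqP ?]; subst; constructor 3.
  + by left; exists j, q, r, s.
  + left; exists j, p, r, s; rewrite four_AN; split=> //.
    by rewrite [q + q + _]addrC e xorCA.
  + by right; exists i', p, q, s; rewrite negbK.
  + right; exists i', p, q, r; rewrite negbK eq_sym; split=> //.
      by rewrite [s + r]addrC.
    exact: four_AC.
- case/orP => [/orP []|] /andP [/andP [/eqP ? /eqP ?] /eqP ?]; subst; constructor 4.
  + by left; exists (eps p (+) eps q), q, z.
  + left; exists (eps p (+) eps q), p, z; rewrite addbC; split=> //.
      by rewrite [q + q + _]addrC.
    by rewrite four_BN // addbC.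
  + by right; exists i', p, q; rewrite negbK.
Qed.

Definition stem_pt h i (p : bool + R) : T :=
  match p with inl l => I l | inr x => G h i x end.

Lemma stem_pt_inj h i : injective (stem_pt h i).
Proof. by move=> [l|x] [l'|x'] //= [->]. Qed.

Lemma card_stem_set h i (d : {set bool + R}) : #|stem_set h i d| = #|d|.
Proof.
rewrite -(card_imset d (@stem_pt_inj h i)).
congr (#|pred_of_set _|); apply/setP => -[l|[[h' i'] x]]; rewrite inE.
  by apply/idP/imsetP => [ld|[[l'|x] ld //= [->] //]]; exists (inl l).
apply/and3P/imsetP => [[/eqP -> /eqP -> xd]|[[l'|x'] xd //= [-> -> ->] //]].
by exists (inr x).
Qed.

Lemma plus_blocks_card b : plus_blocks b -> #|b| = 4%N \/ #|b| = 6%N.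
Proof.
case=> [h i d Dd|h i p p' q q' pp qq e|h i j p q r s rs e|h i j p q z ej e].
- by rewrite card_stem_set; apply: dD.1.
- by left; rewrite cards4_neq ?plusE.
- by left; rewrite cards4_neq ?plusE.
- by left; rewrite cards4_neq ?plusE.
Qed.

Lemma plus_covered_C h i x x' y : x != x' ->
  covered_once plus_blocks [set G h i x; G h i x'; G h (~~ i) y].
Proof.
move=> xx; case: (oF) => sF eF uF; have [y' [yy fy]] := eF _ _ y xx.
apply: (@covered_once_intro _ _ _ _ _ (four_C h i x x' y y')); rewrite ?inE ?eqxx ?orbT //.
  by apply: PlusC; rewrite // eq_sym.
move=> b /plus_inv q /q {q} [[d _ ->]|[p' [q [q' [pp qq e ->]]]]
  |[[j [q [r [s [rs e ->]]]]]|[k [a [c [s [rs e ->]]]]]]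
  |[[j [q [z [ej e ->]]]]|[k [a [c [ej e ->]]]]]]; rewrite !inE ?plusE //=.
- rewrite eq_sym (negPf xx) /= => /eqP ?; subst.
  case/orP => /eqP ?; subst; first by rewrite (uF _ _ _ yy _ (etrans fy e)) // eq_sym.
  by rewrite four_CC' (uF _ _ _ yy _ (etrans fy (etrans e (sF _ _)))).
- by rewrite eq_sym (negPf xx).
- by rewrite eq_sym (negPf xx).
Qed.

Lemma plus_covered_A h i j r s x : r != s ->
  covered_once plus_blocks [set G h i r; G h i s; G (~~ h) j x].
Proof.
(* The equation of [PlusA] fixes [y + y], the bit being the parity of [r + s]; the same bit then
   forces [eps y] to be [e], which singles out one of the two halves. *)
move=> rs; pose e := par (r + s) (+) i (+) eps x.
pose y := half (bit (par (r + s)) - (x + x) - (r + s)) e.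
have yy : y + y = bit (par (r + s)) - (x + x) - (r + s).
  by rewrite double_half // !parD !parN par_bit par_double parD addbF addbb.
apply: (@covered_once_intro _ _ _ _ _ (four_A (~~ h) j i x y r s)); rewrite ?inE ?negbK ?eqxx ?orbT //.
  apply: PlusA => //; rewrite yy eps_half /e.
  have -> : i (+) eps x (+) (par (r + s) (+) i (+) eps x) = par (r + s).
    by case: (i); case: (eps x); case: (par _).
  by ring.
move=> b /plus_inv q /q {q} [[d _ ->]|[p' [q [q' [pp qq e1 ->]]]]
  |[[k [q [a [c [ac e1 ->]]]]]|[k [a [c [s' [rs' e1 ->]]]]]]
  |[[k [q [z [ej e1 ->]]]]|[k [a [c [ej e1 ->]]]]]]; rewrite !inE ?plusE ?negbK ?plusE //=.
- by rewrite eq_sym (negPf rs).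
- rewrite eq_sym (negPf rs) /= => /eqP ?; subst s'.
  have e2 := congr1 par e1; rewrite parD par_bit parD !par_double /= in e2.
  case/orP => /andP [/eqP ? /eqP ?]; subst.
    rewrite (_ : c = y) //; apply: double_inj.
      by rewrite yy e2 -e1; ring.
    by rewrite eps_half /e e2; case: (i); case: (eps a); case: (eps c).
  rewrite four_AN (_ : a = y) //; apply: double_inj.
    by rewrite yy e2 -e1; ring.
  by rewrite eps_half /e e2; case: (i); case: (eps a); case: (eps c).
- by rewrite eq_sym (negPf rs).
- by rewrite eq_sym (negPf rs).
Qed.

Lemma plus_covered_cross h i j x y z :
  covered_once plus_blocks [set G h i x; G h (~~ i) y; G (~~ h) j z].
Proof.
(* Here [s] is the partner of [z] in the matching selected by [x] and [y]. If it is [z] itself,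
   parity forces [t = false] and a stem point completes the block. *)
pose t := j (+) eps x (+) eps y.
pose s := bit t - (x + x) - (y + y) - z.
have [sz|zs] := eqVneq z s.
  have e0 : x + x + (y + y) + (z + z) = bit t by rewrite {1}sz /s; ring.
  have t0 : t = false.
    by have := congr1 par e0; rewrite par_bit !parD !addbb.
  have ej : j = eps x (+) eps y by move: t0; rewrite /t; case: (j); case: (eps x); case: (eps y).
  apply: (@covered_once_intro _ _ _ _ _ (four_B h i j x y z)); rewrite ?inE ?eqxx ?orbT //.
    by apply: PlusB; rewrite // e0 t0.
  move=> b /plus_inv q /q {q} [[d _ ->]|[p' [q [q' [pp qq e1 ->]]]]
    |[[k [q [a [c [ac e1 ->]]]]]|[k [a [c [s' [rs' e1 ->]]]]]]
    |[[k [q [w [ek e1 ->]]]]|[k [a [c [ek e1 ->]]]]]]; rewrite !inE ?plusE ?negbK ?plusE //=.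
  - move=> /eqP ? hz; subst q; case/eqP: ac.
    have hk : k = j by case/orP: hz => /andP [/eqP ->].
    move: e1; rewrite hk -/t -e0 => /addrI e1.
    case/orP: hz => /andP [_ /eqP hz]; rewrite hz in e1.
      by move/addrI: e1.
    by move: e1; rewrite addrC => /addrI.
  - by move=> /eqP <- /andP [/eqP <- /eqP <-].
have e0 : x + x + (y + y) + (z + s) = bit t by rewrite /s; ring.
apply: (@covered_once_intro _ _ _ _ _ (four_A h i j x y z s)); rewrite ?inE ?eqxx ?orbT //.
  exact: PlusA.
move=> b /plus_inv q /q {q} [[d _ ->]|[p' [q [q' [pp qq e1 ->]]]]
    |[[k [q [a [c [ac e1 ->]]]]]|[k [a [c [s' [rs' e1 ->]]]]]]
    |[[k [q [w [ek e1 ->]]]]|[k [a [c [ek e1 ->]]]]]]; rewrite !inE ?plusE ?negbK ?plusE //=.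
- move=> /eqP ? hz; subst q.
  have hk : k = j by case/orP: hz => /andP [/eqP ->].
  subst k; move: e1; rewrite -/t -e0 => /addrI e1.
  case/orP: hz => /andP [_ /eqP hz]; rewrite hz in e1 *.
    by move/addrI: e1 => ->.
  by move: e1; rewrite addrC => /addrI ->; rewrite four_AC.
- move=> /eqP hq /andP [/eqP hk /eqP hw]; case/eqP: zs; rewrite -hq -hk -hw in ek e1.
  have t0 : t = false by rewrite /t ek; case: (eps x); case: (eps y).
  by move: e0; rewrite t0 -[bit _]/(0 : R) -e1 => /addrI /addrI ->.
Qed.

Lemma plus_covered_stem2 l h i x y :
  covered_once plus_blocks [set I l; G h i x; G h (~~ i) y].
Proof.
pose j := eps x (+) eps y.
(* One of the two points missed by the matching, with the value of [eps] for which [stem_index]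
   returns [l]. *)
pose z := half (- (x + x) - (y + y)) (l (+) eps x (+) (i && j) (+) h).
have zz : z + z = - (x + x) - (y + y).
  by rewrite double_half // parD !parN !par_double.
have el : l = stem_index h i j x z.
  by rewrite /stem_index eps_half; case: (l); case: (eps x); case: (i && j); case: (h).
rewrite set3C.
apply: (@covered_once_intro _ _ _ _ _ (four_B h i j x y z)); rewrite ?inE -?el ?eqxx ?orbT //.
  by apply: PlusB; rewrite // zz; ring.
rewrite el => b /plus_inv q /q {q} [[d _ ->]|[p' [q [q' [pp qq e1 ->]]]]
    |[[k [q [a [c [ac e1 ->]]]]]|[k [a [c [s' [rs' e1 ->]]]]]]
    |[[k [q [w [ek e1 ->]]]]|[k [a [c [ek e1 ->]]]]]]; rewrite !inE ?plusE ?negbK ?plusE //=.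
move=> /eqP hl /eqP ?; subst q k; rewrite (_ : w = z) //; apply: double_inj.
  by rewrite zz -[RHS]addr0 -e1; ring.
move: hl; rewrite /stem_index -/j.
by case: (eps w); case: (eps z); case: (eps x); case: (i && j); case: (h).
Qed.

Lemma stem_indexN h i j x z : stem_index (~~ h) j i z x = ~~ stem_index h i j x z.
Proof.
by rewrite /stem_index andbC; case: (eps x); case: (eps z); case: (i && j); case: h.
Qed.

Lemma plus_covered_stem1_aux h i j x z :
  covered_once plus_blocks [set I (stem_index h i j x z); G h i x; G (~~ h) j z].
Proof.
pose y := half (- (x + x) - (z + z)) (j (+) eps x).
have yy : y + y = - (x + x) - (z + z).
  by rewrite double_half // parD !parN !par_double.
have ej : j = eps x (+) eps y by rewrite eps_half; case: (j); case: (eps x).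
rewrite set3C.
apply: (@covered_once_intro _ _ _ _ _ (four_B h i j x y z)); rewrite ?inE ?eqxx ?orbT //.
  by apply: PlusB; rewrite // yy; ring.
move=> b /plus_inv q /q {q} [[d _ ->]|[p' [q [q' [pp qq e1 ->]]]]
    |[[k [q [a [c [ac e1 ->]]]]]|[k [a [c [s' [rs' e1 ->]]]]]]
    |[[k [q [w [ek e1 ->]]]]|[k [a [c [ek e1 ->]]]]]]; rewrite !inE ?plusE ?negbK ?plusE //=.
- move=> /eqP hl /andP [/eqP hk /eqP ?]; subst w; rewrite -hk in ek hl *.
  rewrite (_ : q = y) //; apply: double_inj.
    by rewrite yy -[RHS]addr0 -e1; ring.
  by move: ek; rewrite {1}ej; case: (eps x); case: (eps q); case: (eps y).
- move=> /eqP hl hz; exfalso; move: hl.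
  case/orP: hz => /andP [/eqP -> /eqP ->].
    by rewrite stem_indexN; case: (stem_index _ _ _ _ _).
  rewrite /stem_index ek.
  by case: (k); case: (eps a); case: (eps c); case: (eps x); case: (h).
Qed.

(** The fourth point may lie in either half. Since [stem_index] changes sign when the halves are
    exchanged, each stem point occurs for exactly one of the two. *)
Lemma plus_covered_stem1 l h i j x z :
  covered_once plus_blocks [set I l; G h i x; G (~~ h) j z].
Proof.
have [->|ne] := eqVneq l (stem_index h i j x z); first exact: plus_covered_stem1_aux.
have -> : l = stem_index (~~ h) j i z x.
  by rewrite stem_indexN; move: ne; case: (l); case: (stem_index _ _ _ _ _).
by rewrite set3CA -{3}(negbK h); apply: plus_covered_stem1_aux.
Qed.

Lemma mem_stem_set h i d p : (stem_pt h i p \in stem_set h i d) = (p \in d).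
Proof. by case: p => [l|x]; rewrite inE /= ?eqxx. Qed.

Lemma plus_covered_stem_aux h i x p q :
  inr x != p -> inr x != q -> p != q ->
  covered_once plus_blocks [set G h i x; stem_pt h i p; stem_pt h i q].
Proof.
move=> xp xq pq; have [d0 [Dd0 [xd pd qd] u]] := design_triple dD xp xq pq.
apply: (@covered_once_intro _ _ _ _ _ (stem_set h i d0)).
- exact: PlusStem.
- by rewrite (mem_stem_set h i d0 (inr x)).
- by rewrite mem_stem_set.
- by rewrite mem_stem_set.
move=> b Pb xb; case: (plus_inv Pb xb) => [[d Dd e]|[p' [r [r' [pp qq e1 e]]]]
    |[[k [r [a [c [ac e1 e]]]]]|[k [a [c [s' [rs' e1 e]]]]]]
    |[[k [r [w [ek e1 e]]]]|[k [a [c [ek e1 e]]]]]].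
- by move: xb; rewrite e (mem_stem_set h i d (inr x)) !mem_stem_set => *; rewrite (u d).
- move: xp xq pq; rewrite {}e; case: p {pd u} => [l|y]; case: q {qd} => [l'|z] //=;
  rewrite !inE ?plusE ?negbK ?plusE //= => xp xq pq /orP [] /eqP ? /orP [] /eqP ?; subst;
  by rewrite ?eqxx in xp xq pq.
- move: xp xq pq; rewrite {}e; case: p {pd u} => [l|y]; case: q {qd} => [l'|z] //=;
  rewrite !inE ?plusE ?negbK ?plusE //= => xp xq pq /eqP ? /eqP ?; subst;
  by rewrite ?eqxx in xp xq pq.
- move: xp xq pq; rewrite {}e; case: p {pd u} => [l|y]; case: q {qd} => [l'|z] //=;
  rewrite !inE ?plusE ?negbK ?plusE //= => xp xq pq /orP [] /eqP ? /orP [] /eqP ?; subst;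
  by rewrite ?eqxx in xp xq pq.
- move: xp xq pq; rewrite {}e; case: p {pd u} => [l|y]; case: q {qd} => [l'|z] //=;
  rewrite !inE ?plusE ?negbK ?plusE //= => xp xq pq /eqP ? /eqP ?; subst;
  by rewrite ?eqxx in xp xq pq.
- move: xp xq pq; rewrite {}e; case: p {pd u} => [l|y]; case: q {qd} => [l'|z] //=;
  rewrite !inE ?plusE ?negbK ?plusE //= => xp xq pq /eqP ? /eqP ?; subst;
  by rewrite ?eqxx in xp xq pq.
Qed.

Lemma plus_covered_stem h i p q r : p != q -> p != r -> q != r ->
  covered_once plus_blocks [set stem_pt h i p; stem_pt h i q; stem_pt h i r].
Proof.
case: p => [l|x]; last exact: plus_covered_stem_aux.
case: q => [l'|x]; last by move=> pq pr qr; rewrite set3C; apply: plus_covered_stem_aux;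
  rewrite // eq_sym.
case: r => [l''|x]; first by case: l l' l'' => -[] [].
by move=> pq pr qr; rewrite set3CA set3C; apply: plus_covered_stem_aux; rewrite // eq_sym.
Qed.

Lemma plus_covered_G h1 i1 x h2 i2 y h3 i3 z :
  G h1 i1 x != G h2 i2 y -> G h1 i1 x != G h3 i3 z -> G h2 i2 y != G h3 i3 z ->
  covered_once plus_blocks [set G h1 i1 x; G h2 i2 y; G h3 i3 z].
Proof.
(* Of three Booleans two agree; this is used for the halves here and for the layers below. *)
wlog e12 : h1 i1 x h2 i2 y h3 i3 z / h1 = h2.
  have [e12|n12] := eqVneq h1 h2; first by apply.
  have [e13|n13] := eqVneq h1 h3 => w xy xz yz.
    by rewrite set3CA; apply: w; rewrite // eq_sym.
  rewrite set3C set3CA; apply: w => //; rewrite 1?eq_sym //.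
  by case: h1 h2 h3 n12 n13 {xy xz yz} => -[] [].
subst h2; have [<-{h3}|/negb_neq ->] := eqVneq h1 h3; last first.
  rewrite !GGE !eqxx; have [<-{i2}|/negb_neq ->] := eqVneq i1 i2.
    by rewrite andbT /= => xy _ _; apply: plus_covered_A.
  by move=> _ _ _; apply: plus_covered_cross.
wlog e12 : i1 x i2 y i3 z / i1 = i2.
  have [e12|n12] := eqVneq i1 i2; first by apply.
  have [e13|n13] := eqVneq i1 i3 => w xy xz yz.
    by rewrite set3CA; apply: w; rewrite // eq_sym.
  rewrite set3C set3CA; apply: w => //; rewrite 1?eq_sym //.
  by case: i1 i2 i3 n12 n13 {xy xz yz} => -[] [].
subst i2; have [<-{i3}|/negb_neq ->] := eqVneq i1 i3.
  by move=> xy xz yz; apply: (@plus_covered_stem h1 i1 (inr x) (inr y) (inr z));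
    rewrite -(inj_eq (@stem_pt_inj h1 i1)).
by rewrite !GGE !eqxx => xy _ _; apply: plus_covered_C.
Qed.

Lemma plus_covered_IG l h1 i1 x h2 i2 y : G h1 i1 x != G h2 i2 y ->
  covered_once plus_blocks [set I l; G h1 i1 x; G h2 i2 y].
Proof.
have [<-{h2}|/negb_neq -> _] := eqVneq h1 h2; last exact: plus_covered_stem1.
have [<-{i2}|/negb_neq -> _] := eqVneq i1 i2; last exact: plus_covered_stem2.
move=> xy; apply: (@plus_covered_stem h1 i1 (inl l) (inr x) (inr y)) => //.
by rewrite -(inj_eq (@stem_pt_inj h1 i1)).
Qed.

Lemma design_plus : design plus_blocks.
Proof.
apply: design_triples; first exact: plus_blocks_card.
move=> [l|[[h1 i1] x]] [l'|[[h2 i2] y]] [l''|[[h3 i3] z]] xy xz yz.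
- by case: l l' l'' xy xz yz => -[] [].
- exact: (@plus_covered_stem h3 i3 (inl l) (inl l') (inr z)).
- by rewrite set3CA; apply: (@plus_covered_stem h2 i2 (inl l) (inl l'') (inr y)).
- exact: plus_covered_IG.
- rewrite set3C set3CA.
  by apply: (@plus_covered_stem h1 i1 (inl l') (inl l'') (inr x)).
- by rewrite set3C; apply: plus_covered_IG.
- by rewrite set3CA set3C; apply: plus_covered_IG.
- exact: plus_covered_G.
Qed.
End QuadruplePlus.

(** * Latin squares and one-factorizations *)

(** The group Z_2^k as nested pairs: a leading bit splits off by computation and can tag disjoint
    copies of a smaller cube. *)
Fixpoint cube k : finType := if k is k'.+1 then (bool * cube k')%type else unit.

Fixpoint cadd k : cube k -> cube k -> cube k :=
  if k is k'.+1 then fun a b => (a.1 (+) b.1, cadd a.2 b.2) else fun _ _ => tt.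

Fixpoint czero k : cube k := if k is k'.+1 then (false, czero k') else tt.

Lemma card_cube k : #|cube k| = 2 ^ k.
Proof. by elim: k => [|k IH]; rewrite ?card_unit //= card_prod card_bool IH expnS. Qed.

Lemma caddC k : commutative (@cadd k).
Proof. by elim: k => [|k IH] [] // a b [c d] /=; rewrite IH addbC. Qed.

Lemma caddA k : associative (@cadd k).
Proof. by elim: k => [|k IH] [] // a b [c d] [e f] /=; rewrite IH addbA. Qed.

Lemma cadd0 k : right_id (czero k) (@cadd k).
Proof. by elim: k => [|k IH] [] //= a b; rewrite IH addbF. Qed.

Lemma caddxx k a : cadd a a = czero k.
Proof. by elim: k a => [|k IH] //= [a b] /=; rewrite IH addbb. Qed.

Lemma caddKK k (a b : cube k) : cadd (cadd a b) b = a.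
Proof. by rewrite -caddA caddxx cadd0. Qed.

Lemma cadd_injr k (b a a' : cube k) : cadd a b = cadd a' b -> a = a'.
Proof. by move=> e; rewrite -(caddKK a b) e caddKK. Qed.

Lemma cadd_injl k (b a a' : cube k) : cadd b a = cadd b a' -> a = a'.
Proof. by rewrite !(caddC b); apply: cadd_injr. Qed.

Section OddOrder.
Variables (n : nat) (odd_n : odd n.+1).
Local Open Scope ring_scope.

(** The multiplier is half of the order plus one, the inverse of two when the order [n.+1] is
    odd. *)
Definition Zhalf (x : 'I_n.+1) := x *+ (n.+2)./2.

Lemma mulrn_order (x : 'I_n.+1) : x *+ n.+1 = 0.
Proof. by apply/val_inj; rewrite Zp_mulrn /= modnMl. Qed.

Lemma Zhalf_double x : Zhalf (x + x) = x.
Proof.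
rewrite /Zhalf -mulr2n -mulrnA mul2n even_halfK; last by rewrite oddS negbK.
by rewrite mulrSr mulrn_order add0r.
Qed.

Lemma Zdouble_half x : Zhalf x + Zhalf x = x.
Proof. by rewrite -{3}(Zhalf_double x) /Zhalf mulrnDl. Qed.

Lemma Zdouble_inj (x y : 'I_n.+1) : x + x = y + y -> x = y.
Proof. by move=> e; rewrite -(Zhalf_double x) e Zhalf_double. Qed.
End OddOrder.

Definition idem_quasigroup (K : finType) (op ldiv : K -> K -> K) :=
  [/\ forall a b, op a b = op b a, forall a, op a a = a,
      forall a b, op a (ldiv a b) = b & forall a b, ldiv a (op a b) = b].

(** The mean [(a + b) / 2] modulo an odd number is commutative and idempotent, with left division
    [2 b - a]. *)
Lemma idem_quasigroup_odd (K : finType) : odd #|K| ->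
  exists op ldiv : K -> K -> K, idem_quasigroup op ldiv.
Proof.
case e: #|K| => [//|n] on.
have [|f [g [fK gK]]] := @card_eq_bij K 'I_n.+1; first by rewrite card_ord.
exists (fun a b => g (Zhalf (f a + f b)%R)).
exists (fun a b => g (f b + f b - f a)%R); split=> [a b|a|a b|a b].
- by rewrite addrC.
- by rewrite Zhalf_double.
- by rewrite gK addrC subrK Zhalf_double.
- by rewrite gK Zdouble_half // addrC addKr.
Qed.

Definition latin (H : finType) (L : H -> H -> H) :=
  (forall x, injective (L x)) /\ (forall y, injective (L^~ y)).

(** A Latin square that contains the Cayley table of Z_2^k. Its constant diagonal lets [odd_factors]
    set one symbol aside. *)
Definition cube_latin k (H : finType) (L : H -> H -> H) (o : H) (phi : cube k -> H) :=
  [/\ latin L, forall x, L x x = o, injective phi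
    & forall a b, L (phi a) (phi b) = phi (cadd a b)].

Lemma cube_latin_sub n :
  cube_latin (k := 0) (fun x y : 'I_n.+1 => x - y)%R 0%R (fun _ => 0%R).
Proof.
split=> [|x|[] []|a b] //; rewrite ?subrr //.
by split=> x y z /=; [move/addrI/oppr_inj | move/addIr].
Qed.

Lemma cube_latin_double k (H : finType) L o phi : @cube_latin k H L o phi ->
  cube_latin (k := k.+1) (fun x y : bool * H => (x.1 (+) y.1, L x.2 y.2)) (false, o)
    (fun a => (a.1, phi a.2)).
Proof.
case=> -[Ll Lr] Lo phi_inj Lphi; split=> [|[b x]|[b a] [c d] [-> /phi_inj ->]|a b] //=.
- split=> -[b x] [c y] [d z] [/= e]; first by move/Ll->; case: b c d e => -[] [].
  by move/Lr->; case: b c d e => -[] [].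
- by rewrite addbb Lo.
- by rewrite Lphi.
Qed.

(* Prolongation of the cyclic square of odd order along the transversals
   y - x = const. *)
Section Prolongation.
Variables (n k : nat) (odd_n : odd n.+1) (iota : cube k -> 'I_n.+1).
Hypotheses (iota_inj : injective iota) (iota0 : iota (czero k) = 0%R).
Local Open Scope ring_scope.
Let H : finType := ('I_n.+1 + cube k)%type.

Let inlI (p q : 'I_n.+1) : (inl p : H) = inl q -> p = q.
Proof. by case. Qed.

Definition iota_inv (x : 'I_n.+1) := [pick c | iota c == x].

Lemma iotaK c : iota_inv (iota c) = Some c.
Proof.
rewrite /iota_inv; case: pickP => [d /eqP /iota_inj -> //|/(_ c)].
by rewrite eqxx.
Qed.

Lemma iota_invK x c : iota_inv x = Some c -> iota c = x.
Proof. by rewrite /iota_inv; case: pickP => [d /eqP <- [<-]|]. Qed.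

(** The entry [x + y] on the transversal [y - x = iota c] equals [x + x + iota c] and
    [y + y - iota c]. It moves to the border column and row, and the new symbol [c] takes its
    place. *)
Definition prolongation (p q : H) : H :=
  match p, q with
  | inl x, inl y => if iota_inv (y - x) is Some c then inr c else inl (x + y)
  | inl x, inr e => inl (x + x + iota e)
  | inr e, inl y => inl (y + y - iota e)
  | inr e, inr e' => inr (cadd e e')
  end.

Lemma cube_latin_prolongation :
  cube_latin prolongation (inr (czero k)) (fun a => inr a).
Proof.
split=> [|[x|e]|a b []|a b] //=; last 2 first.
- by rewrite subrr -iota0 iotaK.
- by rewrite caddxx.
split=> [] [x|e] [y|a] [z|b] //=.
- case ey: (iota_inv (y - x)) => [c|]; case ez: (iota_inv (z - x)) => [d|] //.
    by case=> cd; move/iota_invK: ey; rewrite cd (iota_invK ez) => /addIr ->.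
  by move/inlI/addrI => ->.
- case ey: (iota_inv (y - x)) => [c|] // /inlI /esym; rewrite -addrA => /addrI h.
  by rewrite -h addrAC subrr add0r iotaK in ey.
- case ez: (iota_inv (z - x)) => [c|] // /inlI; rewrite -addrA => /addrI h.
  by rewrite -h addrAC subrr add0r iotaK in ez.
- by move/inlI => /addrI /iota_inj ->.
- by move/inlI => /addIr /(Zdouble_inj odd_n) ->.
- by case=> /cadd_injl ->.
- case ey: (iota_inv (x - y)) => [c|]; case ez: (iota_inv (x - z)) => [d|] //.
    by case=> cd; move/iota_invK: ey; rewrite cd (iota_invK ez) => /addrI /oppr_inj ->.
  by move/inlI/addIr => ->.
- case ey: (iota_inv (x - y)) => [c|] // /inlI h.
  by move: ey; rewrite (_ : x - y = iota b) ?iotaK //;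
     rewrite (addIr x (etrans h (addrAC _ _ _))) opprB addrC subrK.
- case ez: (iota_inv (x - z)) => [c|] // /inlI h.
  by move: ez; rewrite (_ : x - z = iota a) ?iotaK //;
     rewrite (addIr x (etrans (esym h) (addrAC _ _ _))) opprB addrC subrK.
- by move/inlI => /addrI /oppr_inj /iota_inj ->.
- by move/inlI => /addIr /(Zdouble_inj odd_n) ->.
- by case=> /cadd_injr ->.
Qed.
End Prolongation.

Lemma exists_injection (A B : finType) (a : A) (b : B) : #|A| <= #|B| ->
  exists2 f : A -> B, injective f & f a = b.
Proof.
move=> AB; pose f x : B := enum_val (widen_ord AB (enum_rank x)).
have f_inj : injective f.
  move=> x y /enum_val_inj /(congr1 val) /= h; apply: enum_rank_inj.
  exact: val_inj.
(* The transposition of [b] and [f a] corrects the image of the base point. *)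
pose s y := if y == b then f a else if y == f a then b else y.
have sK : involutive s.
  move=> y; rewrite /s; case: (eqVneq y b) => [->|yb]; first by rewrite eqxx; case: eqP.
  by case: (eqVneq y (f a)) => [->|ya]; rewrite ?eqxx // (negPf yb) (negPf ya).
exists (s \o f); first exact: inj_comp (inv_inj sK) f_inj.
by rewrite /= /s eqxx; case: eqP.
Qed.

Lemma exists_cube_latin t : 0 < t -> exists k (H : finType) L o (phi : cube k -> H),
  [/\ t <= 4 * 2 ^ k, #|H| = t & cube_latin L o phi].
Proof.
elim/ltn_ind: t => t IH t0; have [ot|et] := boolP (odd t); last first.
  have tt : t = t./2 * 2 by rewrite muln2 even_halfK.
  have [| |k [H [L [o [phi [tk ct cl]]]]]] := IH t./2; [lia|lia|].
  exists k.+1, (bool * H)%type.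
  exists (fun x y : bool * H => (x.1 (+) y.1, L x.2 y.2)), (false, o), (fun a => (a.1, phi a.2)).
  split; [by rewrite expnS; lia | by rewrite card_prod card_bool ct; lia | ].
  exact: cube_latin_double.
have [t4|t4] := leqP t 4.
  case: t {IH} t0 ot t4 => // t _ _ t4; exists 0, 'I_t.+1.
  exists (fun x y : 'I_t.+1 => x - y)%R, 0%R, (fun _ => 0%R).
  by split; rewrite ?card_ord //; apply: cube_latin_sub.
(* Now [2 * 2 ^ k <= t < 4 * 2 ^ k], so the cube fits into the cyclic group of order [t - 2 ^ k],
   which is odd because [k > 0]. *)
pose k := (trunc_log 2 t).-1.
have l1 : 2 <= trunc_log 2 t by apply: trunc_log_max => //; lia.
have kE : (trunc_log 2 t) = k.+1 by rewrite /k; lia.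
have /andP [lo hi] := trunc_log_bounds (isT : 1 < 2) t0; rewrite kE !expnS in lo hi.
have k1 : 0 < k by lia.
have [n en] : exists n, n.+1 = t - 2 ^ k by exists (t - 2 ^ k).-1; lia.
have on : odd n.+1 by rewrite en oddB ?ot ?oddX ?eqn0Ngt ?k1 //; lia.
have [|iota iota_inj iota0] := @exists_injection (cube k) 'I_n.+1 (czero k) 0%R.
  by rewrite card_cube card_ord en; lia.
exists k, ('I_n.+1 + cube k)%type, (prolongation iota), (inr (czero k)), inr.
split; first by lia.
  by rewrite card_sum card_ord card_cube en; lia.
exact: cube_latin_prolongation.
Qed.

Lemma latin_solve_l (H : finType) (L : H -> H -> H) x c : latin L -> exists y, L x y = c.
Proof. by case=> Ll _; exists (invF (Ll x) c); apply: f_invF. Qed.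

Lemma latin_solve_r (H : finType) (L : H -> H -> H) y c : latin L -> exists x, L x y = c.
Proof.
by case=> _ Lr; exists (invF (Lr y) c); apply: (@f_invF _ (fun x => L x y)).
Qed.

Section OneFactorizations.
Variables (H : finType) (L : H -> H -> H).
Hypothesis lL : latin L.

(** The square is read with the point of layer [false] first, so that the colour of an edge between
    the layers is symmetric. *)
Let cross (i : bool) x y := if i then L y x else L x y.

Lemma cross_inj i x : injective (cross i x).
Proof. by case: lL => Ll Lr; case: i => y z; [apply: Lr | apply: Ll]. Qed.

Lemma cross_solve i x c : exists y, cross i x y = c.
Proof. by case: i; [apply: latin_solve_r | apply: latin_solve_l]. Qed.

Definition even_factors (K : finType) (F : H -> H -> K) (p q : H * bool) : K + H :=
  if p.2 == q.2 then inl (F p.1 q.1) else inr (cross p.2 p.1 q.1).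

Lemma onefact_even (K : finType) (F : H -> H -> K) : onefact F -> onefact (even_factors F).
Proof.
case=> sF eF uF; split=> [[x i] [y j]|[x i] [y j] [z k]|[x i] [y j] [z k]].
- by case: i j => -[]; rewrite /even_factors //= sF.
- rewrite xpair_eqE /even_factors /=; have [_|_] := eqVneq i j; rewrite ?andbT => xy.
    have [w [wz fw]] := eF _ _ z xy; exists (w, k).
    by rewrite xpair_eqE eqxx andbT /= wz fw.
  have [w ew] := cross_solve k z (cross i x y); exists (w, ~~ k).
  by rewrite xpair_eqE negb_eqF' andbF negb_eqF ew.
rewrite /even_factors !xpair_eqE /=; have [<-|ij] := eqVneq i j; have [<-|ik] := eqVneq i k;
  rewrite ?andbT // => yx zx []; first by move/(uF _ _ _ yx zx) ->.
by move/cross_inj ->; rewrite (negb_neq ij) (negb_neq ik).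
Qed.

(** Within a layer the colour [c] of [op] misses the vertex [c], and the edge joining the two copies
    of [c] completes it. These edges use up the diagonal of [L], which is the whole class of one
    symbol; the other symbols remain perfect matchings. *)
Definition odd_factors (op : H -> H -> H) (p q : H * bool) : H + H :=
  if p.2 == q.2 then inl (op p.1 q.1)
  else if p.1 == q.1 then inl p.1 else inr (cross p.2 p.1 q.1).

Lemma onefact_odd (op ldiv : H -> H -> H) o : idem_quasigroup op ldiv ->
  (forall x, L x x = o) -> onefact (odd_factors op).
Proof.
case=> opC opxx op_ldiv ldiv_op Lo.
have cross_o i x y : cross i x y = o -> x = y.
  by move=> e; apply: (@cross_inj i x); rewrite e /cross Lo; case: i {e}.
have op_eq x y : op x y = x -> y = x.
  by move=> e; rewrite -(ldiv_op x y) e -{2}(opxx x) ldiv_op.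
split=> [[x i] [y j]|[x i] [y j] [z k]|[x i] [y j] [z k]].
- rewrite /odd_factors /= opC [j == i]eq_sym [y == x]eq_sym.
  by case: (i) (j) => -[] //=; case: eqP => // ->.
- have inl_case c : exists w, w != (z, k) /\ odd_factors op (z, k) w = inl c.
    have [<-|zc] := eqVneq z c.
      exists (z, ~~ k); rewrite xpair_eqE negb_eqF' andbF; split=> //.
      by rewrite /odd_factors /= negb_eqF eqxx.
    exists (ldiv z c, k); rewrite xpair_eqE eqxx andbT /odd_factors /= eqxx op_ldiv.
    split=> //; apply: contra zc => /eqP e.
    by rewrite -[c](op_ldiv z) e opxx.
  rewrite xpair_eqE; case e: (odd_factors op (x, i) (y, j)) => [c|c] xy.
    exact: inl_case.
  have [w ew] := cross_solve k z c.
  (* Otherwise [c] would be the diagonal symbol [o], which colours no edge. *)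
  have zw : z != w.
    apply/eqP => zw; move: e; rewrite /odd_factors /=; case: ifP => // ij; case: eqP => // nxy [e].
    case: nxy; apply: (@cross_o i); rewrite e -ew -zw /cross Lo.
    by case: (k).
  exists (w, ~~ k); rewrite xpair_eqE negb_eqF' andbF; split=> //.
  by rewrite /odd_factors /= negb_eqF (negPf zw) ew.
rewrite /odd_factors !xpair_eqE /=; have [<-|ij] := eqVneq i j; have [<-|ik] := eqVneq i k;
  rewrite ?andbT // => yx zx.
- by case=> e; rewrite -(ldiv_op x y) e ldiv_op.
- by case: eqP => // _ [/op_eq] e; rewrite e eqxx in yx.
- by case: eqP => // _ [/esym /op_eq] e; rewrite e eqxx in zx.
- rewrite (negb_neq ij) (negb_neq ik).
  by case: eqP => [<-|_]; case: eqP => [<-|_] // [/cross_inj ->].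
Qed.
End OneFactorizations.

Lemma onefact_transport (W W' K : finType) (F : W -> W -> K) (f : W -> W') (g : W' -> W) :
  cancel f g -> cancel g f -> onefact F -> onefact (fun x y => F (g x) (g y)).
Proof.
move=> fK gK [sF eF uF]; split=> [x y|x y z xy|x y z yx zx].
- exact: sF.
- have [|w [wz e]] := eF (g x) (g y) (g z); first by rewrite (can_eq gK).
  by exists (f w); rewrite fK; split=> //; apply: contra wz => /eqP <-; rewrite fK.
- by move/uF; rewrite !(can_eq gK) => h; apply: (can_inj gK); apply: h.
Qed.

Lemma onefact_card (W W' K : finType) (F : W -> W -> K) : #|W| = #|W'| -> onefact F ->
  exists F' : W' -> W' -> K, onefact F'.
Proof.
case/card_eq_bij => f [g [fK gK]] oF; exists (fun x y => F (g x) (g y)).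
exact: onefact_transport fK gK oF.
Qed.

Lemma exists_cube_onefact t : 0 < t ->
  exists k (H K : finType) (F : H * bool -> H * bool -> K) (phi : cube k -> H),
  [/\ t <= 4 * 2 ^ k, #|H| = t, onefact F, injective phi & forall a b c d,
     a != b -> c != d -> cadd a b = cadd c d ->
     F (phi a, false) (phi b, true) = F (phi c, false) (phi d, true)].
Proof.
elim/ltn_ind: t => t IH t0.
have [k [H [L [o [phi [tk Ht [lL Lo phi_inj Lphi]]]]]]] := exists_cube_latin t0.
have [ot|et] := boolP (odd t).
  have [|op [ldiv iq]] := @idem_quasigroup_odd H; first by rewrite Ht.
  exists k, H, (H + H)%type, (odd_factors L op), phi; split=> //.
    exact: (onefact_odd lL iq Lo).
  move=> a b c d ab cd e; rewrite /odd_factors /= !(inj_eq phi_inj) (negPf ab) (negPf cd).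
  by rewrite !Lphi e.
(* The induction hypothesis only supplies a one-factorization for the layers; the cube sits in the
   square [L] between them. *)
have [| |k' [H' [K [F [phi' [_ H't oF _ _]]]]]] := IH t./2; [lia|lia|].
have [|F' oF'] := onefact_card (W' := H) _ oF; first by rewrite card_prod card_bool H't Ht; lia.
exists k, H, (K + H)%type, (even_factors L F'), phi; split=> //.
  exact: onefact_even.
by move=> a b c d _ _ e; rewrite /even_factors /= !Lphi e.
Qed.

(** * Existence for all even orders *)

(** Colours are renamed by the neighbours of [z0], which leaves exactly those that occur and makes
    their number |W| - 1. *)
Lemma onefact_colouring (W K : finType) (F : W -> W -> K) (z0 z1 : W) :
  z1 != z0 -> onefact F ->
  exists (C : finType) (c : W -> W -> C) (mate : C -> W -> W),
  [/\ #|C| = #|W|.-1, forall x y, c x y = c y x,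
      forall a x, mate a x != x /\ c x (mate a x) = a,
      forall x y, x != y -> mate (c x y) x = y
    & forall x y z w, F x y = F z w -> c x y = c z w].
Proof.
move=> z10 [sF eF uF]; pose C : finType := {y : W | y != z0}.
(* The default [z1] can be reached only for [x = y]. *)
pose c x y : C := odflt (exist _ z1 z10) [pick a : C | F z0 (val a) == F x y].
pose mate (a : C) x : W := odflt x [pick w | (w != x) && (F x w == F z0 (val a))].
have cE x y : x != y -> F z0 (val (c x y)) = F x y.
  rewrite /c => /(eF _ _ z0) [w [wz fw]]; case: pickP => [a /eqP //|].
  by move/(_ (exist _ w wz)); rewrite /= fw eqxx.
have mateE a x : mate a x != x /\ F x (mate a x) = F z0 (val a).
  have [|w [wx fw]] := eF z0 (val a) x; first by rewrite eq_sym (valP a).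
  rewrite /mate; case: pickP => [w' /andP [? /eqP] //|/(_ w)].
  by rewrite wx fw eqxx.
exists C, c, mate; split=> [|x y|a x|x y xy|x y z w e].
- by rewrite card_sig -(cardC1 z0); apply: eq_card => y; rewrite !inE.
- by rewrite /c sF.
- have [mx fx] := mateE a x; split=> //; apply: val_inj.
  apply: (uF z0); [exact: (valP (c _ _)) | exact: (valP a) | ].
  by rewrite cE // eq_sym.
- have [mx fx] := mateE (c x y) x; apply: (uF x) => //; first by rewrite eq_sym.
  by rewrite fx cE.
- by rewrite /c e.
Qed.

(** The common interface of the three constructions, with [i0] and [i1] the two copies of [W]. Equal
    edges are excluded because over them the [4m - 2] construction has a block of size six. *)
Definition extends_factors v (W K : finType) (F : W -> W -> K) :=
  exists (T : finType) (i0 i1 : W -> T) (P : {set T} -> Prop),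
  [/\ #|T| = v, injective i0 /\ injective i1, forall x y, i0 x != i1 y, design P &
      forall z z' w w', z != z' -> w != w' -> F z z' = F w w' -> w != z -> w != z' ->
      P [set i0 z; i0 z'; i1 w; i1 w']].

Lemma extends_double (W K : finType) (F : W -> W -> K) :
  onefact F -> has_design W -> extends_factors (2 * #|W|) F.
Proof.
move=> oF [P dP]; exists (W * bool)%type, (pair^~ false), (pair^~ true), (double_blocks F P).
split=> [|||| z z' w w' zz ww e _ _].
- by rewrite card_prod card_bool mulnC.
- by split=> x y [].
- by move=> x y; rewrite xpair_eqE andbF.
- exact: design_double.
- exact: DoubleCross.
Qed.

Lemma extends_quad (W K : finType) (F : W -> W -> K) : 0 < #|W| -> ~~ odd #|W| ->
  onefact F -> has_design W -> (forall T : finType, #|T| = 2 * #|W| - 2 -> has_design T) ->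
  extends_factors (4 * #|W| - 2) F.
Proof.
move=> W0 evW oF [D dD] hC.
have /card_gt0P [z0 _] := W0.
have /card_gt0P [z1] : 0 < #|predC1 z0| by rewrite cardC1; lia.
rewrite inE /= => z10.
have [C [c [mate [cC c_sym mateP mate_c cF]]]] := onefact_colouring z10 oF.
have [|P dP] := hC (C * bool)%type; first by rewrite card_prod card_bool cC; lia.
have [|op [ldiv [opC opxx op_ldiv ldiv_op]]] := @idem_quasigroup_odd C.
  by rewrite cC; lia.
exists ((C + W) * bool)%type, (fun z => (inr z, false)), (fun z => (inr z, true)).
exists (quad_blocks c mate op P D); split=> [||||z z' w w' zz ww e wz wz'].
- rewrite card_prod card_sum card_bool cC.
  by case: #|W| W0 => // m _; lia.
- by split=> x y [].
- by move=> x y; rewrite xpair_eqE andbF.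
- have mate_neq a x : mate a x != x by case: (mateP a x).
  have c_mate a x : c x (mate a x) = a by case: (mateP a x).
  exact: (design_quad c_sym mate_neq c_mate mate_c opC opxx op_ldiv ldiv_op dP dD).
- exact: (@QuadZZ _ _ _ _ _ _ _ false _ _ _ _ zz ww (cF _ _ _ _ e)).
Qed.

Section EvenCyclic.
Variable n : nat.
Hypothesis even_n : ~~ odd n.
Local Open Scope ring_scope.
Let R : finComNzRingType := 'I_n.+2.

Definition Zpar (x : R) := odd x.
Definition Zeps (x : R) := ((n.+2)./2 <= x)%N.
(** The two solutions of [x + x = e] for even [e], told apart by [Zeps]. *)
Definition Zhalves (e : R) (b : bool) : R := inZp (e./2 + b * (n.+2)./2).

Lemma ZparD x y : Zpar (x + y) = Zpar x (+) Zpar y.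
Proof. by rewrite /Zpar /= odd_mod ?oddD //= negbK; exact: negbTE. Qed.

Lemma val_Zhalves e b : Zhalves e b = (e./2 + b * (n.+2)./2)%N :> nat.
Proof.
rewrite /= modn_small //; have := ltn_ord e; have := even_n.
by case: b => /=; rewrite -?[(n.+2)./2]/((n./2).+1)%N; lia.
Qed.

Lemma Zdouble_halves e b : Zpar e = false -> Zhalves e b + Zhalves e b = e.
Proof.
rewrite /Zpar => oe; apply: val_inj.
rewrite -[LHS]/((Zhalves e b + Zhalves e b) %% n.+2)%N val_Zhalves.
have -> : (e./2 + b * (n.+2)./2 + (e./2 + b * (n.+2)./2) = b * n.+2 + e)%N.
  by have := even_n; case: b; lia.
by rewrite modnMDl modn_small.
Qed.

Lemma Zeps_halves e b : Zeps (Zhalves e b) = b.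
Proof.
rewrite /Zeps val_Zhalves; have := ltn_ord e; have := even_n.
by case: b => /= ? ?; apply/idP; lia.
Qed.

Lemma Zeps_inj (x y : R) : x + x = y + y -> Zeps x = Zeps y -> x = y.
Proof.
move=> /(congr1 val) /= e; rewrite /Zeps => h; apply: val_inj => /=.
have := ltn_ord x; have := ltn_ord y; have := even_n; move: e h.
set X := nat_of_ord x; set Y := nat_of_ord y => e h en yn xn.
(* The doubles have equal remainders, and their quotients, 0 or 1, are what [Zeps] records. *)
have [a ea] : exists a, (X + X = a * n.+2 + (X + X) %% n.+2)%N by exists ((X + X) %/ n.+2)%N; exact: divn_eq.
have [b eb] : exists b, (Y + Y = b * n.+2 + (Y + Y) %% n.+2)%N by exists ((Y + Y) %/ n.+2)%N; exact: divn_eq.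
have rl := ltn_pmod (Y + Y) (isT : 0 < n.+2)%N; rewrite -e in eb rl; move: ea eb rl.
move: (_ %% _)%N => r ea eb rl.
have a2 : (a < 2)%N by rewrite -(ltn_pmul2r (isT : 0 < n.+2)%N); lia.
have b2 : (b < 2)%N by rewrite -(ltn_pmul2r (isT : 0 < n.+2)%N); lia.
by case: a b a2 b2 ea eb h => [|[|//]] [|[|//]] _ _; lia.
Qed.
End EvenCyclic.

Lemma extends_plus (W K : finType) (F : W -> W -> K) : 0 < #|W| -> ~~ odd #|W| ->
  onefact F -> (forall T : finType, #|T| = #|W| + 2 -> has_design T) ->
  extends_factors (4 * #|W| + 2) F.
Proof.
move=> W0 evW oF hD; have [n en] : exists n, #|W| = n.+2 by exists (#|W| - 2); lia.
have even_n : ~~ odd n by rewrite en /= negbK in evW.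
pose R : finComNzRingType := 'I_n.+2.
have [|f [g [fK gK]]] := @card_eq_bij W R; first by rewrite en card_ord.
have [|D dD] := hD (bool + R)%type; first by rewrite card_sum card_bool card_ord en; lia.
have oF' := onefact_transport fK gK oF.
exists (bool + bool * bool * R)%type.
exists (fun z => inr (false, false, f z)), (fun z => inr (false, true, f z)).
exists (plus_blocks (@Zeps n) (fun x y : R => F (g x) (g y)) D).
split=> [||||z z' w w' zz ww e wz wz'].
- by rewrite card_sum !card_prod !card_bool card_ord en; lia.
- by split=> x y [] /(can_inj fK).
- by [].
- exact: (design_plus (ZparD even_n) _ (Zdouble_halves even_n) (Zeps_halves even_n)
    (Zeps_inj even_n) oF' dD).
- by apply: (@PlusC _ _ _ _ _ false false); rewrite ?(can_eq fK) ?fK.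
Qed.

(** With [|W| = 2 * t], multiples of 4 are [2 * |W|], orders 6 modulo 8 are [4 * |W| - 2] and orders
    2 modulo 8 are [4 * |W| + 2]. The factor 10 comes from [v = 8 * t + 2] with [t = 1]. *)
Lemma extends_step v : ~~ odd v -> 4 <= v ->
  (forall T : finType, #|T| < v -> ~~ odd #|T| -> has_design T) ->
  exists t, [/\ 0 < t, v <= 10 * t & forall (H K : finType) (F : H * bool -> H * bool -> K),
    #|H| = t -> onefact F -> extends_factors v F].
Proof.
move=> ev v4 IH.
have cW (H : finType) : #|{: H * bool}| = 2 * #|H| by rewrite card_prod card_bool mulnC.
have [d4|d4] := boolP (4 %| v).
  exists (v %/ 4); split=> [||H K F Ht oF]; [lia|lia|].
  rewrite (_ : v = 2 * #|{: H * bool}|); last by rewrite cW Ht; lia.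
  by apply: extends_double => //; apply: IH; rewrite cW Ht; lia.
have [d8|d8] := boolP (8 %| v + 2).
  exists ((v + 2) %/ 8); split=> [||H K F Ht oF]; [lia|lia|].
  rewrite (_ : v = 4 * #|{: H * bool}| - 2); last by rewrite cW Ht; lia.
  apply: extends_quad => //; [rewrite cW Ht; lia | rewrite cW Ht; lia | |].
    by apply: IH; rewrite cW Ht; lia.
  by move=> T; rewrite cW Ht => cT; apply: IH; rewrite cT; lia.
exists ((v - 2) %/ 8); split=> [||H K F Ht oF]; [lia|lia|].
rewrite (_ : v = 4 * #|{: H * bool}| + 2); last by rewrite cW Ht; lia.
apply: extends_plus => //; [rewrite cW Ht; lia | rewrite cW Ht; lia | ].
by move=> T; rewrite cW Ht => cT; apply: IH; rewrite cT; lia.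
Qed.

Lemma exists_design (T : finType) : ~~ odd #|T| -> has_design T.
Proof.
have [v] := ubnP #|T|; elim: v T => // v IH T Tv evT.
have [T4|T4] := leqP 4 #|T|; last first.
  exists (fun _ => False); split=> // t t3; have := subset_leq_card (subsetT t).
  by rewrite t3 cardsT; lia.
have [T' Tv'|t [t0 _ ext]] := extends_step evT T4; first by apply: IH; lia.
have [k [H [K [F [_ [_ Ht oF _ _]]]]]] := exists_cube_onefact t0.
have [T' [_ [_ [P [cT _ _ dP _]]]]] := ext _ _ _ Ht oF.
by apply: (has_design_card cT); exists P.
Qed.

(** Two bits of the cube are spent on tagging the four copies, hence [k'.+2]. The factor 40 is 10
    from [extends_step] times 4 from [exists_cube_onefact]. *)
Lemma exists_cube_design v : ~~ odd v -> 4 <= v ->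
  exists k, v <= 40 * 2 ^ k /\ forall k', k = k'.+2 ->
  exists (T : finType) (P : {set T} -> Prop) (u : bool * bool * cube k' -> T),
  [/\ #|T| = v, design P, injective u & forall a b c,
    P [set u (false, false, a); u (false, true, b); u (true, false, c);
           u (true, true, cadd (cadd a b) c)]].
Proof.
move=> ev v4.
have [T _ evT|t [t0 vt ext]] := extends_step ev v4; first exact: exists_design.
have [k [H [K [F [phi [tk Ht oF phi_inj phiF]]]]]] := exists_cube_onefact t0.
have [T [i0 [i1 [P [cT [i0I i1I] i01 dP PF]]]]] := ext _ _ _ Ht oF.
exists k; split=> [|k' ek]; first by lia.
subst k; exists T, P.
(* The bit [j] differs at the two ends of an edge, so their sum in the cube is nonzero; the bit [i]
   separates the edges used in the two copies of [W]. *)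
pose w (i : bool) (j : bool) (a : cube k') : H * bool := (phi (j, (i, a)), j).
have wI i j j' a b : w i j a = w i j' b -> j = j' /\ a = b.
  by case=> /phi_inj [-> ->].
exists (fun p => if p.1.1 then i1 (w true p.1.2 p.2) else i0 (w false p.1.2 p.2)).
split=> // [[[[] j] a] [[[] j'] b] /=|a b c /=].
- by move/i1I/wI => [-> ->].
- by move=> e; have := i01 (w false j' b) (w true j a); rewrite e eqxx.
- by move=> e; have := i01 (w false j a) (w true j' b); rewrite e eqxx.
- by move/i0I/wI => [-> ->].
apply: PF; rewrite ?xpair_eqE ?andbF //.
- apply: phiF; rewrite ?xpair_eqE //=; congr (_, (_, _)).
  by rewrite [RHS]caddC caddKK.
- by rewrite andbT (inj_eq phi_inj) !xpair_eqE.
Qed.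

(** * Replacing a Latin cube *)

Definition latin_cube (E : finType) (f : E -> E -> E -> E) :=
  [/\ forall b c, injective (fun a => f a b c), forall a c, injective (fun b => f a b c)
    & forall a b, injective (f a b)].

Section Replacement.
Variables (T E : finType) (P : {set T} -> Prop) (u : bool * bool * E -> T).
Hypotheses (dP : design P) (u_inj : injective u).

Definition quad a b c d : {set T} :=
  [set u (false, false, a); u (false, true, b); u (true, false, c); u (true, true, d)].

Variable f0 : E -> E -> E -> E.
Hypotheses (f0_latin : latin_cube f0) (Pf0 : forall a b c, P (quad a b c (f0 a b c))).

Definition is_quad (f : E -> E -> E -> E) (s : {set T}) :=
  exists a b c, s = quad a b c (f a b c).

Definition replaced f (s : {set T}) := (P s /\ ~ is_quad f0 s) \/ is_quad f s.

Lemma mem_quad i j x a b c d : (u (i, j, x) \in quad a b c d) =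
  (x == if i then (if j then d else c) else (if j then b else a)).
Proof.
rewrite !inE !(inj_eq u_inj) !xpair_eqE.
by case: i; case: j; rewrite /= ?orbF.
Qed.

Lemma card_quad a b c d : #|quad a b c d| = 4.
Proof. by rewrite cards4_neq ?(inj_eq u_inj) // !xpair_eqE. Qed.

(** Three points of a quad fix three of its coordinates, and in a Latin cube any three determine the
    fourth. *)
Lemma latin_cube_cover f (t : {set T}) a b c d : latin_cube f ->
  #|t| = 3 -> t \subset quad a b c d ->
  exists2 s, is_quad f s /\ t \subset s &
    forall s', is_quad f s' -> t \subset s' -> s' = s.
Proof.
have solve (h : E -> E) e : injective h -> exists x, h x = e.
  by move=> hI; exists (invF hI e); apply: f_invF.
case=> fa fb fc t3 /(subset4_cards3 t3) [] ->.
- exists (quad a b c (f a b c)) => [|_ [a' [b' [c' ->]]]]; rewrite subset3 !mem_quad.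
    by rewrite !eqxx; split=> //; exists a, b, c.
  by case/and3P => /eqP <- /eqP <- /eqP <-.
- have [c0 e] := solve (f a b) d (@fc a b).
  exists (quad a b c0 (f a b c0)) => [|_ [a' [b' [c' ->]]]]; rewrite subset3 !mem_quad.
    by rewrite e !eqxx; split=> //; exists a, b, c0; rewrite e.
  by case/and3P => /eqP <- /eqP <- /eqP; rewrite -e => /fc ->.
- have [b0 e] := solve _ d (@fb a c).
  exists (quad a b0 c (f a b0 c)) => [|_ [a' [b' [c' ->]]]]; rewrite subset3 !mem_quad.
    by rewrite e !eqxx; split=> //; exists a, b0, c; rewrite e.
  by case/and3P => /eqP <- /eqP <- /eqP; rewrite -e => /fb ->.
- have [a0 e] := solve _ d (@fa b c).
  exists (quad a0 b c (f a0 b c)) => [|_ [a' [b' [c' ->]]]]; rewrite subset3 !mem_quad.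
    by rewrite e !eqxx; split=> //; exists a0, b, c; rewrite e.
  by case/and3P => /eqP <- /eqP <- /eqP; rewrite -e => /fa ->.
Qed.

(** The quads of [f0] and those of [f] cover the same triples, namely those with points in three
    different copies of [E], each exactly once. *)
Lemma design_replaced f : latin_cube f -> design (replaced f).
Proof.
move=> f_latin; split=> [s [[/(dP.1) //]|[a [b [c ->]]]]|t t3].
  by left; apply: card_quad.
have [s0 [Ps0 ts0 us0]] := dP.2 t t3.
have [[a [b [c es0]]]|nq] := pselect (is_quad f0 s0).
  rewrite es0 in ts0; have [s [qs ts] us] := latin_cube_cover f_latin t3 ts0.
  exists s; split=> [|//|s' [[Ps' nq] ts'|qs' ts']]; first by right.
    by case: nq; rewrite (us0 s') // es0; exists a, b, c.
  exact: us.
exists s0; split=> [|//|s' [[Ps' _] ts'|[a [b [c es']]] ts']]; first by left.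
  exact: us0.
rewrite es' in ts'; have [s [qs ts] us] := latin_cube_cover f0_latin t3 ts'.
have Ps : P s by case: (qs) => a' [b' [c' ->]].
by case: nq; rewrite -(us0 s).
Qed.

(** The value at [a], [b], [c] is read off the block through the corresponding points of the first
    three copies. *)
Lemma replaced_inj f g : latin_cube g -> (forall s, replaced f s -> replaced g s) ->
  forall a b c, f a b c = g a b c.
Proof.
move=> g_latin fg a b c; have dg := design_replaced g_latin.
pose x := u (false, false, a); pose y := u (false, true, b); pose z := u (true, false, c).
have xy : x != y by rewrite (inj_eq u_inj).
have xz : x != z by rewrite (inj_eq u_inj).
have yz : y != z by rewrite (inj_eq u_inj).
have [s0 [_ _ us]] := design_triple dg xy xz yz.
have ef : quad a b c (f a b c) = s0.
  apply: us; rewrite ?mem_quad ?eqxx //.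
  by apply: fg; right; exists a, b, c.
have eg : quad a b c (g a b c) = s0.
  apply: us; rewrite ?mem_quad ?eqxx //.
  by right; exists a, b, c.
have : u (true, true, f a b c) \in s0 by rewrite -ef mem_quad.
by rewrite -eg mem_quad => /eqP.
Qed.
End Replacement.

(** * Counting Latin cubes *)

Section GreedyCount.
Variables (S D : finType) (conf : S -> S -> D -> D -> bool) (d0 : D) (K : nat).
Hypothesis conf_sym : forall p q x y, conf p q x y = conf q p y x.
Hypothesis free_choice : forall (d : {ffun S -> D}) p,
  K <= #|[set x | [forall q, (q != p) ==> ~~ conf p q x (d q)]]|.

(** An assignment on the sites of [s] is a total function with value [d0] elsewhere, so that none is
    counted twice. *)
Definition free_on (s : seq S) (d : {ffun S -> D}) :=
  [forall q, (q \notin s) ==> (d q == d0)] &&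
  [forall p, [forall q, [&& p \in s, q \in s & p != q] ==> ~~ conf p q (d p) (d q)]].

Lemma free_onP (s : seq S) (d : {ffun S -> D}) : reflect ((forall q, q \notin s -> d q = d0) /\
    forall p q, p \in s -> q \in s -> p != q -> ~~ conf p q (d p) (d q))
  (free_on s d).
Proof.
apply: (iffP andP) => -[h1 h2]; split.
- by move=> q qs; apply/eqP; move/forallP/(_ q)/implyP: h1; apply.
- move=> p q ps qs pq; move/forallP/(_ p)/forallP/(_ q)/implyP: h2; apply.
  by rewrite ps qs.
- by apply/forallP => q; apply/implyP => /h1 ->.
- by apply/forallP => p; apply/forallP => q; apply/implyP => /and3P [? ? ?]; apply: h2.
Qed.

Definition upd (d : {ffun S -> D}) p x := [ffun q => if q == p then x else d q].

Lemma free_on_count (s : seq S) : uniq s -> K ^ size s <= #|[set d | free_on s d]|.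
Proof.
elim: s => [_|p s IH /andP [ps us]].
  rewrite expn0 card_gt0; apply/set0Pn; exists [ffun=> d0].
  by rewrite inE; apply/free_onP; split=> // q _; rewrite ffunE.
pose ok d x := [forall q, (q != p) ==> ~~ conf p q x (d q)].
(* Pairs of an assignment on [s] and a compatible value at [p]. The map [upd] is injective on them
   because the old value at [p] was [d0]. *)
pose Z := [set z : {ffun S -> D} * D | free_on s z.1 & ok z.1 z.2].
have cZ : K ^ size (p :: s) <= #|Z|.
  have -> : #|Z| = \sum_(d | free_on s d) #|[set x | ok d x]|.
    rewrite -sum1_card (eq_bigl (fun z => free_on s z.1 && ok z.1 z.2)).
      rewrite -(pair_big_dep (free_on s) ok (fun _ _ => 1)) /=; apply: eq_bigr => d _.
      by rewrite sum1_card; apply: eq_card => x; rewrite !inE.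
    by move=> z; rewrite inE.
  apply: leq_trans (_ : \sum_(d | free_on s d) K <= _); last first.
    by apply: leq_sum => d _; apply: free_choice.
  rewrite sum_nat_const /= expnS mulnC leq_mul2r; apply/orP; right.
  by apply: leq_trans (IH us) _; apply: eq_leq; apply: eq_card => d; rewrite inE.
apply: leq_trans cZ _.
rewrite -(card_in_imset (f := fun z => upd z.1 p z.2)).
  apply: subset_leq_card; apply/subsetP => _ /imsetP [[d x] + ->] /=.
  rewrite !inE /= => /andP [/free_onP [h1 h2] /forallP okx].
  apply/free_onP; split=> [q|q r].
    by rewrite inE negb_or ffunE => /andP [/negPf -> /h1].
  rewrite !inE !ffunE; have [->|qp] := eqVneq q p; have [->|rp] := eqVneq r p;
    rewrite ?eqxx //= => ? ? qr.
  - by move: (okx r); rewrite rp.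
  - by rewrite conf_sym; move: (okx q); rewrite qp.
  - exact: h2.
move=> [d x] [d' x']; rewrite !inE /= => /andP [/free_onP [h1 _] _] /andP [/free_onP [h1' _] _].
move/ffunP => e; have ex := e p; rewrite !ffunE eqxx in ex; congr (_, _) => //.
apply/ffunP => q; have := e q; rewrite !ffunE; case: eqP => // -> _.
by rewrite h1 // h1'.
Qed.

Lemma greedy_count :
  K ^ #|S| <= #|[set d : {ffun S -> D} |
    [forall p, [forall q, (p != q) ==> ~~ conf p q (d p) (d q)]]]|.
Proof.
have := free_on_count (enum_uniq S); rewrite -cardT => h; apply: leq_trans h _.
apply: subset_leq_card; apply/subsetP => d; rewrite !inE => /free_onP [_ h].
by apply/forallP => p; apply/forallP => q; apply/implyP; apply: h; rewrite mem_enum.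
Qed.
End GreedyCount.

(* The linear cube is modified on pairwise disjoint boxes p + {0, (1, d p)}^3,
   one for each site p: on the box of p the value is shifted by (1, d p). Boxes
   with first bits (i, j, l) can only meet boxes with the same first bits, so
   the disjointness is a condition [clash p q (d p) (d q)] on pairs of sites. *)
Section Boxes.
Variable k : nat.
Local Notation V := (cube k).
Local Notation D := (cube k.+4).
Local Notation E := (cube k.+4.+1).
Local Notation S := (V * V * V)%type.

Local Arguments cadd : simpl never.

Lemma cadd_flip n (x : cube n.+1) (y : cube n) :
  cadd x ((true, y) : cube n.+1) = (~~ x.1, cadd x.2 y).
Proof. by rewrite -addbT. Qed.

Definition emb (v : V) : D := (false, (false, (false, (false, v)))).

Definition shift (i : bool) (v : V) (x : D) : D := if i then cadd (emb v) x else emb v.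

(** A cell is split into its first bits and the rest; this is the rest for the corner with first
    bits [e] of the box of [p] in direction [(true, x)]. *)
Definition corner (e : bool * bool * bool) (p : S) (x : D) :=
  (shift e.1.1 p.1.1 x, shift e.1.2 p.1.2 x, shift e.2 p.2 x).

Definition clash (p q : S) (x y : D) := [exists e, corner e p x == corner e q y].

Lemma emb_inj : injective emb.
Proof. by move=> x y []. Qed.

Lemma emb_add v w : cadd (emb v) (emb w) = emb (cadd v w).
Proof. by []. Qed.

Lemma clash_sym p q x y : clash p q x y = clash q p y x.
Proof. by apply: eq_existsb => e; rewrite eq_sym. Qed.

Lemma shift_eq i v w x y : shift i v x = shift i w y ->
  if i then x = cadd (emb (cadd v w)) y else v = w.
Proof.
case: i => [e|/emb_inj //].
have {}e : cadd (emb v) x = cadd (emb w) y by [].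
by rewrite -emb_add -caddA -e caddA caddxx caddC cadd0.
Qed.

Lemma shift_flip i v x : cadd (shift i v x) x = shift (~~ i) v x.
Proof. by case: i => //; apply: caddKK. Qed.

Definition translate (i : bool) (w v : V) := if i then cadd v w else v.

(** At a common corner a bit 0 forces equal coordinates of [p] and [q], and a bit 1 forces [x] and
    [y] to differ by the sum of those coordinates. As [p != q] some bit is 1, and one [w] serves all
    such coordinates. *)
Lemma clash_translate p q x y : p != q -> clash p q x y ->
  exists e w, x = cadd (emb w) y /\
    q = (translate e.1.1 w p.1.1, translate e.1.2 w p.1.2, translate e.2 w p.2).
Proof.
case: p q => [[p1 p2] p3] [[q1 q2] q3] pq /existsP [[[e1 e2] e3]] /eqP [].
move=> /shift_eq h1 /shift_eq h2 /shift_eq h3; exists (e1, e2, e3) => /=.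
have [w ew] : exists w, x = cadd (emb w) y.
  case: e1 h1 => [->|h1]; first by exists (cadd p1 q1).
  case: e2 h2 => [->|h2]; first by exists (cadd p2 q2).
  case: e3 h3 => [->|h3]; first by exists (cadd p3 q3).
  by rewrite h1 h2 h3 eqxx in pq.
have tr (i : bool) v v' : (if i then x = cadd (emb (cadd v v')) y else v = v') ->
    v' = translate i w v.
  case: i => // h; have /emb_inj -> : emb w = emb (cadd v v').
    by apply: (@cadd_injr k.+4 y); rewrite -ew.
  by rewrite /= caddC [cadd v v']caddC caddKK.
by exists w; split=> //; rewrite -(tr _ _ _ h1) -(tr _ _ _ h2) -(tr _ _ _ h3).
Qed.

(** The corner [e] and the translation [w] determine both [q] and the forbidden [x], so at most
    [8 * 2 ^ k] of the [16 * 2 ^ k] directions are lost. *)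
Lemma clash_free (d : {ffun S -> D}) p :
  2 ^ k <= #|[set x | [forall q, (q != p) ==> ~~ clash p q x (d q)]]|.
Proof.
pose X := [set x | [forall q, (q != p) ==> ~~ clash p q x (d q)]].
pose h (z : bool * bool * bool * V) := cadd (emb z.2)
  (d (translate z.1.1.1 z.2 p.1.1, translate z.1.1.2 z.2 p.1.2, translate z.1.2 z.2 p.2)).
have sub : ~: X \subset [set h z | z in setT].
  apply/subsetP => x; rewrite !inE negb_forall => /existsP [q].
  rewrite negb_imply negbK eq_sym => /andP [pq /(clash_translate pq) [e [w [ex eq]]]].
  by apply/imsetP; exists (e, w); rewrite // /h -eq.
have le8 : #|~: X| <= 8 * 2 ^ k.
  apply: leq_trans (subset_leq_card sub) _; apply: leq_trans (leq_imset_card _ _) _.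
  by rewrite cardsT !card_prod !card_bool card_cube.
have := cardsC X; rewrite -/X card_cube !expnS; lia.
Qed.

Definition box_free (d : {ffun S -> D}) :=
  [forall p, [forall q, (p != q) ==> ~~ clash p q (d p) (d q)]].

Definition site (d : {ffun S -> D}) (x y z : E) : option S :=
  [pick p | corner (x.1, y.1, z.1) p (d p) == (x.2, y.2, z.2)].

Definition box_shift d x y z : E :=
  if site d x y z is Some p then (true, d p) else czero _.

Definition box_cube d x y z : E := cadd (cadd (cadd x y) z) (box_shift d x y z).

Lemma siteE d x y z p : box_free d ->
  corner (x.1, y.1, z.1) p (d p) = (x.2, y.2, z.2) -> site d x y z = Some p.
Proof.
move=> /forallP fd e; rewrite /site; case: pickP => [q /eqP eq|/(_ p)]; last by rewrite e eqxx.
congr Some; apply/eqP; apply: contraT => qp.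
move/forallP/(_ p)/implyP/(_ qp)/negP: (fd q); case.
by apply/existsP; exists (x.1, y.1, z.1); rewrite eq e.
Qed.

Lemma site_corner d x y z p : site d x y z = Some p ->
  corner (x.1, y.1, z.1) p (d p) = (x.2, y.2, z.2).
Proof. by rewrite /site; case: pickP => // q /eqP e [<-]. Qed.

(** A step along an axis in the direction of the box leads to another corner of the same box;
    outside the boxes the step is zero. *)
Lemma box_shift_x d x y z : box_free d ->
  box_shift d (cadd x (box_shift d x y z)) y z = box_shift d x y z.
Proof.
move=> fd; rewrite {2 3}/box_shift; case e: (site d x y z) => [p|]; last first.
  by rewrite cadd0 /box_shift e.
rewrite cadd_flip /box_shift (@siteE _ _ _ _ p) //=.
by case: (site_corner e) => <- <- <-; rewrite shift_flip.
Qed.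

Lemma box_shift_y d x y z : box_free d ->
  box_shift d x (cadd y (box_shift d x y z)) z = box_shift d x y z.
Proof.
move=> fd; rewrite {2 3}/box_shift; case e: (site d x y z) => [p|]; last first.
  by rewrite cadd0 /box_shift e.
rewrite cadd_flip /box_shift (@siteE _ _ _ _ p) //=.
by case: (site_corner e) => <- <- <-; rewrite shift_flip.
Qed.

Lemma box_shift_z d x y z : box_free d ->
  box_shift d x y (cadd z (box_shift d x y z)) = box_shift d x y z.
Proof.
move=> fd; rewrite {2 3}/box_shift; case e: (site d x y z) => [p|]; last first.
  by rewrite cadd0 /box_shift e.
rewrite cadd_flip /box_shift (@siteE _ _ _ _ p) //=.
by case: (site_corner e) => <- <- <-; rewrite shift_flip.
Qed.

Lemma caddAC n : right_commutative (@cadd n).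
Proof. by move=> x y z; rewrite -!caddA (caddC y). Qed.

Lemma invariant_shift_inj (g : E -> E) :
  (forall x, g (cadd x (g x)) = g x) -> injective (fun x => cadd x (g x)).
Proof.
move=> gE x y e; have eg : g x = g y by rewrite -gE e gE.
by move: e; rewrite eg => /cadd_injr.
Qed.

Lemma box_cube_latin d : box_free d -> latin_cube (box_cube d).
Proof.
move=> fd; split=> [y z x x'|x z y y'|x y z z']; rewrite /box_cube.
- rewrite ![cadd (cadd _ z) _]caddAC ![cadd (cadd _ y) _]caddAC.
  move/cadd_injr/cadd_injr; apply: (@invariant_shift_inj (fun x => box_shift d x y z)).
  by move=> v; apply: box_shift_x.
- rewrite ![cadd (cadd _ z) _]caddAC ![cadd x _]caddC ![cadd (cadd _ x) _]caddAC.
  move/cadd_injr/cadd_injr; apply: (@invariant_shift_inj (fun y => box_shift d x y z)).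
  by move=> v; apply: box_shift_y.
- rewrite ![cadd (cadd x y) _]caddC ![cadd (cadd _ (cadd x y)) _]caddAC.
  move/cadd_injr; apply: (@invariant_shift_inj (fun z => box_shift d x y z)).
  by move=> v; apply: box_shift_z.
Qed.

Lemma linear_cube_latin : latin_cube (fun x y z : E => cadd (cadd x y) z).
Proof.
split=> [y z x x' /cadd_injr /cadd_injr //|x z y y' /cadd_injr /cadd_injl //|x y z z'].
exact: cadd_injl.
Qed.

(** At the base corner of the box of [p] the shift is [(true, d p)], which reveals [d p]. *)
Lemma box_cube_inj d d' : box_free d -> box_free d' ->
  (forall x y z, box_cube d x y z = box_cube d' x y z) -> d = d'.
Proof.
move=> fd fd' e; apply/ffunP => -[[p1 p2] p3].
have /cadd_injl := e (false, emb p1) (false, emb p2) (false, emb p3).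
by rewrite /box_shift !(@siteE _ _ _ _ (p1, p2, p3)) // => -[].
Qed.

Lemma box_free_count : (2 ^ k) ^ ((2 ^ k) ^ 3) <= #|[set d | box_free d]|.
Proof.
have := greedy_count (czero k.+4) clash_sym clash_free.
by rewrite !card_prod card_cube [(2 ^ k) ^ 3]expnSr -mulnn.
Qed.
End Boxes.

(** * Lower bound for the number of designs *)

Lemma transport_set4 (T T' : finType) (f : T -> T') (g : T' -> T) P x y z w :
  cancel f g -> P [set x; y; z; w] ->
  transport_blocks f P [set f x; f y; f z; f w].
Proof.
move=> fK; rewrite /transport_blocks; congr P.
by apply/setP => p; rewrite !inE !(can_eq fK).
Qed.

Lemma N_S3_46_lower v k (T : finType) (P : {set T} -> Prop)
    (u : bool * bool * cube k.+4.+1 -> T) :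
  #|T| = v -> design P -> injective u ->
  (forall a b c, P [set u (false, false, a); u (false, true, b); u (true, false, c);
     u (true, true, cadd (cadd a b) c)]) ->
  (2 ^ k) ^ ((2 ^ k) ^ 3) <= N_S3_46 v.
Proof.
move=> cT dP uI Pu.
have [|f [g [fK gK]]] := @card_eq_bij T 'I_v; first by rewrite card_ord.
have dP' := design_transport fK gK dP.
have fuI : injective (f \o u) by apply: inj_comp uI; apply: can_inj fK.
have Pfu a b c : transport_blocks f P (quad (f \o u) a b c (cadd (cadd a b) c)).
  exact: transport_set4 fK (Pu a b c).
pose B d := [set s | `[< replaced (transport_blocks f P) (f \o u)
  (fun a b c => cadd (cadd a b) c) (@box_cube k d) s >]].
have dB d : box_free d -> is_S3_46 (B d).
  move=> fd; apply: design_is_S3_46; apply: design_replaced => //.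
    exact: linear_cube_latin.
  exact: box_cube_latin.
apply: leq_trans (box_free_count k) _; rewrite -(card_in_imset (f := B)).
  apply: subset_leq_card; apply/subsetP => _ /imsetP [d + ->].
  by rewrite !inE => /dB.
move=> d d'; rewrite !inE => fd fd' /setP e; apply: box_cube_inj => //.
apply: (replaced_inj dP' fuI (@linear_cube_latin k) Pfu (box_cube_latin fd')) => s.
by move=> /asboolP h; have := e s; rewrite !inE h => /esym /asboolP.
Qed.

(** Two bits go to the tags of the four copies and five to the boxes, so [2 * n <= 40 * 2 ^ (j + 7)]
    with [q = 2 ^ j], which gives the factor 2560. *)
Lemma N_S3_46_power n : 1280 < n -> exists q,
  n <= 2560 * q /\ q ^ (q ^ 3) <= N_S3_46 (2 * n).
Proof.
move=> n0; have [||k [nk hk]] := @exists_cube_design (2 * n); [lia|lia|].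
(* Since [2 * n > 2560 = 40 * 2 ^ 6], at least seven bits are available. *)
have k7 : 6 < k by rewrite -(ltn_exp2l _ _ (isT : 1 < 2)) -[2 ^ 6]/64; lia.
have [j ek] : exists j, k = j.+4.+3 by exists (k - 7); lia.
subst k; exists (2 ^ j); split; first by rewrite !expnS in nk; lia.
have [T [P [u [cT dP uI Pu]]]] := hk j.+4.+1 erefl.
exact: N_S3_46_lower cT dP uI Pu.
Qed.

(* The logarithmic estimate *)
From Stdlib Require Import Reals Lra.
Open Scope R_scope.

Lemma INR_expn (a b : nat) : INR (expn a b) = INR a ^ b.
Proof. by elim: b => //= b IH; rewrite expnS mult_INR IH. Qed.

Lemma INR_leq (a b : nat) : (a <= b)%nat -> INR a <= INR b.
Proof. by move/leP; apply: le_INR. Qed.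

Theorem theorem3 :
  exists c : R, 0 < c /\
    exists n0 : nat, forall n : nat, (n0 <= n)%nat ->
      c * INR n ^ 3 * ln (INR n) < ln (INR (N_S3_46 (2 * n))).
Proof.
have C0 : 0 < 2560 ^ 3 by lra.
(* Passing from [n] to [q] costs [2560 ^ 3] in the cube and 2 in the logarithm; the other factor 2
   makes the inequality strict. *)
exists (/ (4 * 2560 ^ 3)); split; first by apply: Rinv_0_lt_compat; lra.
(* From this threshold on [q >= 2560], hence [n <= 2560 q <= q ^ 2]. *)
exists (muln 2560 2560) => n n0.
have [|q [nq Nq]] := @N_S3_46_power n; first by apply: leq_trans n0.
have {}n0 : 2560 * 2560 <= INR n.
  by have := INR_leq n0; rewrite mult_INR !INR_IZR_INZ.
have {}nq : INR n <= 2560 * INR q.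
  by have := INR_leq nq; rewrite mult_INR [INR 2560]INR_IZR_INZ.
have q1 : 2560 <= INR q by lra.
have n2 : INR n <= INR q ^ 2 by nra.
have lq : ln (INR n) <= 2 * ln (INR q).
  rewrite -[2]/(INR 2) -ln_pow; last by lra.
  by case: n2 => [/ln_increasing h|->]; [apply: Rlt_le; apply: h; lra | lra].
have l0 : 0 < ln (INR n) by rewrite -ln_1; apply: ln_increasing; lra.
have n3 : INR n ^ 3 <= 2560 ^ 3 * INR q ^ 3.
  by rewrite -Rpow_mult_distr; apply: pow_incr; lra.
have lN : INR q ^ 3 * ln (INR q) <= ln (INR (N_S3_46 (2 * n))).
  have {}Nq := INR_leq Nq; rewrite INR_expn in Nq.
  rewrite -INR_expn -ln_pow; last by lra.
  have p0 : 0 < INR q ^ (expn q 3) by apply: pow_lt; lra.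
  by case: Nq => [/ln_increasing h|->]; [apply: Rlt_le; apply: h | lra].
have n30 : 0 < INR n ^ 3 by apply: pow_lt; lra.
apply: Rlt_le_trans lN.
move: (ln (INR n)) (ln (INR q)) (INR n ^ 3) (INR q ^ 3) lq l0 n3 n30 => L M A B lq l0 n3 n30.
have AL : A * L <= 2560 ^ 3 * B * (2 * M) by apply: Rmult_le_compat; lra.
have AL0 : 0 < A * L by apply: Rmult_lt_0_compat.
rewrite Rmult_assoc; apply: (Rmult_lt_reg_l (4 * 2560 ^ 3)); first by lra.
by rewrite -Rmult_assoc Rinv_r; lra.
Qed.
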